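(* Let $G$ and $H$ be locally compact groups and let $A=A_\pi$ be a closed translation-invariant subalgebra of $B(G)$ for which $\Delta(A)$ is a $*$-semigroup consisting of norm-one elements. Let $\alpha: Y\to\Delta(A)$ be a continuous affine map defined on an open coset $Y$ of $H$. Then $j_\alpha: A\to B(H)$, given by $j_\alpha(u)(h)=\langle\alpha(h),u\rangle$ for $h\in Y$ and $j_\alpha(u)(h)=0$ for $h\in H\setminus Y$, is a completely contractive homomorphism.
   Context: $B(G)$ is the Fourier–Stieltjes algebra. For a continuous unitary representation $\{\pi,\mathcal H_\pi\}$ of $G$, $A_\pi$ is the closed linear span in $B(G)$ of the functions $\xi*_\pi\eta(s)=\langle\pi(s)\xi|\eta\rangle$, and $VN_\pi$ is the von Neumann algebra generated by $\pi(G)$, identified with $A_\pi^*$ via $\langle T,\xi*_\pi\eta\rangle=\langle T\xi|\eta\rangle$. Closed translation-invariant subspaces of $B(G)$ are exactly the $A_\pi$'s; $A_\pi$ has the operator space structure of the predual of $VN_\pi$, and $B(H)$ that of the predual of $W^*(H)$. $\Delta(A)\subseteq A^*=VN_\pi$ is the Gelfand spectrum with the weak$^*$-topology; ''$\Delta(A)$ is a $*$-semigroup'' means that it is closed under the product and involution of $VN_\pi$. A subgroup of the semigroup $\Delta(A)$ is a subset that is a group under the multiplication of $\Delta(A)$ (its identity being an idempotent of $\Delta(A)$). A map $\alpha$ from a coset $Y\subseteq H$ into a group $F$ is affine if $\alpha(xy^{-1}z)=\alpha(x)\alpha(y)^{-1}\alpha(z)$ for all $x,y,z\in Y$; a map $\alpha:Y\to\Delta(A)$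 is affine if it maps $Y$ into some subgroup $F$ of $\Delta(A)$ and is affine as a map into $F$. Open cosets of $H$ are cosets of open subgroups. *)

(* Defs.v *)
From HB Require Import structures.
From mathcomp Require Import all_boot all_order all_algebra sesquilinear.
From mathcomp Require Import complex.
From mathcomp Require Import all_classical all_reals all_analysis.

Set Implicit Arguments.
Unset Strict Implicit.
Unset Printing Implicit Defensive.

Import Order.TTheory GRing.Theory Num.Theory.
Import numFieldNormedType.Exports.

Local Open Scope classical_set_scope.
Local Open Scope ring_scope.
Local Open Scope complex_scope.

HB.mixin Record isTopologicalGroup G of Topological G & Group G := {
  mulg_continuous : continuous (fun x : G * G => (x.1 * x.2)%g);
  invg_continuous : continuous (fun x : G => (x^-1)%g)
}.

#[short(type="topologicalGroupType")]
HB.structure Definition TopologicalGroup :=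
  {G of Topological G & Group G & isTopologicalGroup G}.

Definition locally_compact_group (G : topologicalGroupType) : Prop :=
  hausdorff_space G /\ locally_compact [set: G].

(* The inner product is linear in its first argument. *)
Record hilbertType (R : realType) := Hilbert {
  hilbert_sort :> completeNormedModType R[i];
  hdot : {dot hilbert_sort for Num.conj};
  hdot_norm : forall x, hdot x x = `|x| ^+ 2
}.

Arguments hdot {R V} : rename.

(* The norm of a normed module over [R[i]] takes its (real nonnegative) values
   in [R[i]]; [rnorm] takes them in [R]. *)
Definition rnorm (R : realType) (V : normedModType R[i]) (x : V) : R :=
  complex.Re `|x|.

Section Operators.
Context {R : realType}.

Definition bounded_op (V : hilbertType R) : set (V -> V) :=
  [set T | linear T /\ continuous T].

Definition adjoint_of (V : hilbertType R) (T S : V -> V) : Prop :=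
  forall x y, hdot (T x) y = hdot x (S y).

Definition opnorm (V : hilbertType R) (T : V -> V) : \bar R :=
  ereal_sup [set (rnorm (T x))%:E | x in [set x | rnorm x <= 1]].

Definition commutant (V : hilbertType R) (M : set (V -> V)) : set (V -> V) :=
  [set T | bounded_op T /\ forall S, M S -> T \o S = S \o T].

Definition von_neumann_algebra (V : hilbertType R) (M : set (V -> V)) : Prop :=
  (forall T, M T -> exists2 S, adjoint_of T S & M S) /\
  commutant (commutant M) = M.

Definition generated_vNA (V : hilbertType R) (S : set (V -> V)) :
    set (V -> V) :=
  [set T | forall M, von_neumann_algebra M -> S `<=` M -> M T].

(* Norm of the operator matrix [T] on the Hilbert sum of [#|I|] copies of [W];
   for [W = R[i]] this is the C*-norm of a scalar matrix. *)
Definition mxop_norm (W : normedModType R[i]) (I : finType)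
    (T : I -> I -> W -> W) : \bar R :=
  ereal_sup [set (Num.sqrt (\sum_k rnorm (\sum_l T k l (x l)) ^+ 2))%:E |
    x in [set x : I -> W | \sum_l rnorm (x l) ^+ 2 <= 1]].

Definition cmx_norm (I : finType) (a : I -> I -> R[i]) : \bar R :=
  mxop_norm (fun k l (z : R[i]^o) => a k l *: z).

End Operators.

Record unitary_rep (R : realType) (G : topologicalGroupType)
    (V : hilbertType R) := UnitaryRep {
  rep_fun :> G -> V -> V;
  rep_linear : forall s, linear (rep_fun s);
  rep1 : rep_fun 1%g = id;
  repM : forall s t, rep_fun (s * t)%g = rep_fun s \o rep_fun t;
  rep_unitary : forall s x y, hdot (rep_fun s x) (rep_fun s y) = hdot x y;
  rep_continuous : forall x, continuous (fun s => rep_fun s x)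
}.

Section FourierStieltjes.
Context {R : realType} {G : topologicalGroupType}.

Definition coef (V : hilbertType R) (pi : unitary_rep G V) (x y : V) :
    G -> R[i] :=
  fun s => hdot (pi s x) y.

Definition fourier_stieltjes : set (G -> R[i]) :=
  [set u | exists (V : hilbertType R) (pi : unitary_rep G V) (x y : V),
    u = coef pi x y].

Definition fs_norm (u : G -> R[i]) : R :=
  inf [set r | exists (V : hilbertType R) (pi : unitary_rep G V) (x y : V),
    u = coef pi x y /\ r = rnorm x * rnorm y].

Definition fs_closure (S : set (G -> R[i])) : set (G -> R[i]) :=
  [set u | fourier_stieltjes u /\
    forall e : R, 0 < e -> exists2 v, S v & fs_norm (u \- v) < e].

Definition coef_span (V : hilbertType R) (pi : unitary_rep G V) :
    set (G -> R[i]) :=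
  [set u | exists n (c : 'I_n -> R[i]) (x y : 'I_n -> V),
    u = fun s => \sum_i c i * coef pi (x i) (y i) s].

(* The space A_pi of the literature; the closure is taken in B(G). *)
Definition coef_space (V : hilbertType R) (pi : unitary_rep G V) :
    set (G -> R[i]) :=
  fs_closure (coef_span pi).

Definition rep_vNA (V : hilbertType R) (pi : unitary_rep G V) :
    set (V -> V) :=
  generated_vNA (range pi).

Definition bounded_functional (A : set (G -> R[i]))
    (phi : (G -> R[i]) -> R[i]) : Prop :=
  (forall (c : R[i]) u v, A u -> A v ->
     phi (fun s => c * u s + v s) = c * phi u + phi v) /\
  exists C : R, forall u, A u -> complex.Re `|phi u| <= C * fs_norm u.

(* [phi] is the functional on A_pi identified with [T] *)
Definition represents (V : hilbertType R) (pi : unitary_rep G V)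
    (T : V -> V) (phi : (G -> R[i]) -> R[i]) : Prop :=
  bounded_functional (coef_space pi) phi /\
  forall x y, phi (coef pi x y) = hdot (T x) y.

(* The duality <T, u> between VN_pi = [rep_vNA pi] and A_pi. The functional represented by
   [T] is unique on A_pi because coefficient functions are total there; the
   value outside of VN_pi and A_pi is irrelevant. *)
Definition pairing (V : hilbertType R) (pi : unitary_rep G V)
    (T : V -> V) (u : G -> R[i]) : R[i] :=
  xget 0 [set z | exists2 phi, represents pi T phi & z = phi u].

(* The norm on the n x n matrices over A_pi as the predual of VN_pi: the norm
   of the map VN_pi -> M_n, T |-> (<T, u i j>), in CB(VN_pi, M_n). *)
Definition predual_mxnorm (V : hilbertType R) (pi : unitary_rep G V) n
    (u : 'M[G -> R[i]]_n) : \bar R :=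
  ereal_sup [set r | exists m (T : 'M[V -> V]_m),
    [/\ forall k l, rep_vNA pi (T k l),
        (mxop_norm (fun k l => T k l) <= 1)%E &
        r = cmx_norm (fun p q : 'I_m * 'I_n =>
              pairing pi (T p.1 q.1) (u p.2 q.2))]].

Definition translation_invariant (A : set (G -> R[i])) : Prop :=
  forall u s, A u ->
    A (fun t => u (s * t)%g) /\ A (fun t => u (t * s)%g).

Record closed_translation_invariant_subalgebra (A : set (G -> R[i])) :
    Prop := {
  ctisa_sub : A `<=` fourier_stieltjes;
  ctisa_closed : fs_closure A `<=` A;
  ctisa0 : A (fun=> 0);
  ctisaP : forall (c : R[i]) u v, A u -> A v -> A (fun s => c * u s + v s);
  ctisaM : forall u v, A u -> A v -> A (fun s => u s * v s);
  ctisa_translation : translation_invariant A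
}.

Definition spectrum (V : hilbertType R) (pi : unitary_rep G V) :
    set (V -> V) :=
  [set T | [/\ rep_vNA pi T,
    exists2 u, coef_space pi u & pairing pi T u != 0 &
    forall u v, coef_space pi u -> coef_space pi v ->
      pairing pi T (fun s => u s * v s) = pairing pi T u * pairing pi T v]].

(* The weak* topology on A_pi^* = VN_pi is the initial topology of this map. *)
Definition weak_star_embedding (V : hilbertType R) (pi : unitary_rep G V)
    (T : V -> V) : {ptws set_type (coef_space pi) -> R[i]^o} :=
  fun u => pairing pi T (set_val u).

Definition positive_definite (p : G -> R[i]) : Prop :=
  forall n (c : 'I_n -> R[i]) (s : 'I_n -> G),
    0 <= \sum_i \sum_j c i * (c j)^* * p ((s j)^-1 * s i)%g.

Definition normalized_pd : set (G -> R[i]) :=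
  [set p | [/\ continuous (p : G -> R[i]^o), positive_definite p &
               p 1%g = 1]].

(* [pi] is the Hilbert direct sum of the GNS representations of all the
   continuous positive definite functions [p] with [p 1 = 1], where [x p] is
   the cyclic vector of [p]. This determines [pi] up to unitary equivalence,
   and VN_pi is then W*(G). *)
Definition universal_rep (V : hilbertType R) (pi : unitary_rep G V) : Prop :=
  exists x : (G -> R[i]) -> V,
  [/\ forall p, normalized_pd p -> coef pi (x p) (x p) = p,
      forall p q, normalized_pd p -> normalized_pd q -> p <> q ->
        forall s, coef pi (x p) (x q) s = 0 &
      dense [set v : V | exists n (c : 'I_n -> R[i]) (s : 'I_n -> G)
          (p : 'I_n -> G -> R[i]),
        (forall i, normalized_pd (p i)) /\
        v = \sum_i c i *: pi (s i) (x (p i))]].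

End FourierStieltjes.

Arguments weak_star_embedding {R G V} pi T.

Definition star_semigroup (R : realType) (V : hilbertType R)
    (D : set (V -> V)) : Prop :=
  (forall S T, D S -> D T -> D (S \o T)) /\
  (forall T, D T -> exists2 S, adjoint_of T S & D S).

Record semigroup_subgroup (V : Type) (D F : set (V -> V)) (e : V -> V)
    (inv : (V -> V) -> (V -> V)) : Prop := {
  sgrp_sub : F `<=` D;
  sgrp_id : F e;
  sgrp_mul : forall S T, F S -> F T -> F (S \o T);
  sgrp_mul1 : forall T, F T -> e \o T = T /\ T \o e = T;
  sgrp_inv : forall T, F T -> F (inv T);
  sgrp_mulV : forall T, F T -> inv T \o T = e /\ T \o inv T = e
}.

Definition affine_map (H : groupType) (Y : set H) (V : Type)
    (D : set (V -> V)) (alpha : H -> V -> V) : Prop :=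
  exists (F : set (V -> V)) (e : V -> V) (inv : (V -> V) -> (V -> V)),
  [/\ semigroup_subgroup D F e inv,
      forall h, Y h -> F (alpha h) &
      forall x y z, Y x -> Y y -> Y z ->
        alpha (x * y^-1 * z)%g = alpha x \o inv (alpha y) \o alpha z].

Definition open_coset (H : topologicalGroupType) (Y : set H) : Prop :=
  exists (K : set H) (a : H),
  [/\ open K, K 1%g, forall x y, K x -> K y -> K (x * y^-1)%g &
      Y = [set (a * k)%g | k in K]].

Definition j_map (R : realType) (G H : topologicalGroupType)
    (V : hilbertType R) (pi : unitary_rep G V) (Y : set H)
    (alpha : H -> V -> V) (u : G -> R[i]) : H -> R[i] :=
  fun h => if h \in Y then pairing pi (alpha h) u else 0.

(* B(H) carries the operator space structure of the predual of W*(H) = VN_om,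
   [om] being the universal representation of [H]. *)
Record completely_contractive_hom (R : realType) (G H : topologicalGroupType)
    (V : hilbertType R) (pi : unitary_rep G V)
    (W : hilbertType R) (om : unitary_rep H W)
    (j : (G -> R[i]) -> (H -> R[i])) : Prop := {
  cch_fs : forall u, coef_space pi u -> fourier_stieltjes (j u);
  cch_linear : forall (c : R[i]) u v, coef_space pi u -> coef_space pi v ->
    j (fun s => c * u s + v s) = fun h => c * j u h + j v h;
  cch_mul : forall u v, coef_space pi u -> coef_space pi v ->
    j (fun s => u s * v s) = fun h => j u h * j v h;
  cch_contractive : forall n (u : 'M[G -> R[i]]_n),
    (forall k l, coef_space pi (u k l)) ->
    (predual_mxnorm om (map_mx j u) <= predual_mxnorm pi u)%E
}.

(* Main.v *)
From HB Require Import structures.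
Require Import Defs.
From mathcomp Require Import all_boot all_order all_algebra sesquilinear.
From mathcomp Require Import complex ring lra.
From mathcomp Require Import all_classical all_reals all_analysis.

Set Implicit Arguments.
Unset Strict Implicit.
Unset Printing Implicit Defensive.

Import Order.TTheory GRing.Theory Num.Theory.
Import numFieldNormedType.Exports.
Import ComplexField.Normc.

Local Open Scope classical_set_scope.
Local Open Scope ring_scope.
Local Open Scope complex_scope.

(** Let [j] be the map of the theorem, [A] the algebra [coef_space pi] and [F] the
    group that contains the values of [alpha].

    The identity of [F] is a contractive idempotent, hence an orthogonal
    projection, and the elements of [F] are partial isometries with this initial
    and final projection, whose inverses are their adjoints
    ([contraction_group_adjoint]). If [Y = a K], then
    [k |-> alpha (a)^* alpha (a k)] is a continuous unitary representation of
    the open subgroup [K], and [<alpha (.) x, y>], extended by zero outside of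
    [Y], is a coefficient of the representation of [H] induced by it. The induced
    representation is not built as a space. Its positive definite functions form
    a positive definite matrix ([induced_matrix_pd]), and a Gelfand-Naimark-Segal
    argument realizes such a matrix by vectors in a finite multiple of the
    universal representation [om] ([gns]): a cyclic vector is split off for one
    index and the Schur complement is treated by induction. The outcome is
    [induced_coefficients]: given families [x] and [z], all the functions
    [<alpha (.) x_i, z_j>] are obtained from vectors of a multiple of [om] whose
    norms do not exceed those of the [x_i] and [z_j].

    This has to be known for all elements of [A], which is a closure in [B(G)], and
    not only for coefficients of [pi]. An element of [A] is a coefficient of
    some representation [sg] of [G], and by closedness and translation invariance
    of [A] its two vectors may be taken in an invariant subspace over which all
    coefficients of [sg] are in [A] ([coef_projection_exists]). There each element
    of the spectrum of [A], being a bounded functional on [A], defines an operator.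
    The resulting map is multiplicative and involutive ([ext_comp],
    [ext_adjoint]): both sides of these identities are bounded functionals
    on [A] that agree on the coefficients of [pi]. Hence [F] also acts in [sg],
    [induced_coefficients] applies to this action, and [j u] is in [B(H)] with
    norm at most the norm of [u] ([j_pair_coef]).

    Consequently the adjoint of [j] takes an operator [T] of [W*(H)] to an
    operator [S] of [VN_pi] ([j_adjoint]), where the pairing of [W*(H)]
    with [B(H)] is computed by [pairing_pair_coef]. The control of the norms in
    [induced_coefficients] for whole families of vectors shows that a contractive
    matrix [T_kl] is taken to a contractive matrix [S_kl]
    ([j_adjoint_contraction]). As [<S_kl, u> = <T_kl, j u>], every value that
    competes for the matrix norm of [j u] also competes for that of [u]. *)

(** * Complex numbers *)

Section ComplexNumbers.
Context {R : realType}.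
Implicit Types (z w : R[i]) (a c s : R).

Lemma ReD z w : complex.Re (z + w) = complex.Re z + complex.Re w.
Proof. by case: z; case: w. Qed.

Lemma ReN z : complex.Re (- z) = - complex.Re z.
Proof. by case: z. Qed.

Lemma ReB z w : complex.Re (z - w) = complex.Re z - complex.Re w.
Proof. by rewrite ReD ReN. Qed.

Lemma ReZ a z : complex.Re (a%:C * z) = a * complex.Re z.
Proof. by case: z => x y /=; rewrite mul0r subr0. Qed.

Lemma ReJ z : complex.Re (conjc z) = complex.Re z.
Proof. by case: z. Qed.

Lemma conjcD z w : conjc (z + w) = conjc z + conjc w.
Proof. exact: rmorphD. Qed.

Lemma conjcN z : conjc (- z) = - conjc z.
Proof. exact: rmorphN. Qed.

Lemma conjcM z w : conjc (z * w) = conjc z * conjc w.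
Proof. exact: rmorphM. Qed.

Lemma conjc_sum I (r : seq I) (P : pred I) (F : I -> R[i]) :
  conjc (\sum_(i <- r | P i) F i) = \sum_(i <- r | P i) conjc (F i).
Proof. exact: rmorph_sum. Qed.

Lemma normc_ge0 z : 0 <= normc z.
Proof. by case: z => x y /=; rewrite sqrtr_ge0. Qed.

Lemma sqr_normcE z : normc z ^+ 2 = complex.Re z ^+ 2 + complex.Im z ^+ 2.
Proof. by case: z => x y /=; rewrite sqr_sqrtr // addr_ge0 ?sqr_ge0. Qed.

Lemma normc_sq z : z * conjc z = (normc z ^+ 2)%:C.
Proof.
rewrite sqr_normcE; case: z => x y /=.
by apply/eqP; rewrite eq_complex /=; apply/andP; split; apply/eqP; ring.
Qed.

Lemma normc_real a : normc a%:C = `|a|.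
Proof. by rewrite /= expr0n /= addr0 sqrtr_sqr. Qed.

Lemma normc_conj z : normc (conjc z) = normc z.
Proof. by case: z => x y /=; rewrite sqrrN. Qed.

Lemma normc_ReE z : complex.Re `|z| = normc z.
Proof. by []. Qed.

Lemma ge0_ReE z : 0 <= z -> z = (complex.Re z)%:C.
Proof. by move=> /ger0_real /RRe_real ->. Qed.

Lemma normc_eq0P z : (forall e : R, 0 < e -> normc z ^+ 2 <= e) -> z = 0.
Proof.
move=> h; apply: eq0_normc; apply/eqP.
rewrite -(@sqrf_eq0 R) eq_le sqr_ge0 andbT.
by apply/ler_addgt0Pl => e e0; rewrite addr0; apply: h.
Qed.

Lemma normc_sqD z w : normc (z + w) ^+ 2 <= 2 * normc z ^+ 2 + 2 * normc w ^+ 2.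
Proof.
rewrite !sqr_normcE; case: z w => x y [u v] /=.
by have := sqr_ge0 (x - u); have := sqr_ge0 (y - v); nra.
Qed.

(** All the Cauchy-Schwarz inequalities below come from this lemma, the
    hypothesis being the positivity of a form on the span of two vectors. It
    is enough to test [t = - s z] with [s] real. *)
Lemma complex_discriminant a c z : 0 <= a -> 0 <= c ->
  (forall t : R[i], 0 <= a + 2 * complex.Re (conjc t * z) + normc t ^+ 2 * c) ->
  normc z ^+ 2 <= a * c.
Proof.
move=> a0 c0 h.
have {}h s : 0 <= a - 2 * s * normc z ^+ 2 + s ^+ 2 * normc z ^+ 2 * c.
  have := h (- (s%:C * z)).
  rewrite normcN normcM normc_real conjcN conjcM conjc_real mulNr ReN -(mulrA s%:C) ReZ.
  rewrite [conjc z * z]mulrC normc_sq /= exprMn real_normK ?num_real //.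
  by lra.
have := normc_ge0 z; set n := normc z in h * => n0.
have [c1|c1] := ltrP 0 c; last first.
  have c1' : c = 0 by apply/eqP; rewrite eq_le c0 c1.
  rewrite c1' mulr0 leNgt; apply/negP => np.
  (* The polynomial is affine in [s]; this [s] is where it takes the value -1. *)
  have := h ((a + 1) / (2 * n ^+ 2)).
  have -> : a - 2 * ((a + 1) / (2 * n ^+ 2)) * n ^+ 2 = -1 by field; nra.
  by rewrite c1' mulr0; lra.
have := h (c^-1).
have -> : a - 2 * c^-1 * n ^+ 2 + c^-1 ^+ 2 * n ^+ 2 * c = a - n ^+ 2 / c by field; lra.
by rewrite subr_ge0 ler_pdivrMr.
Qed.

End ComplexNumbers.

(** * Riesz representation in complete semi-inner product spaces *)

Section SemiInnerProduct.
Context {R : realType} {U : lmodType R[i]} (d : U -> U -> R[i]).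

(** Forms are given as functions, with their properties as hypotheses, so that
    finite powers of a Hilbert space need no new normed space structure. *)
Record semi_inner_product : Prop := {
  sipP : forall c x y z, d (c *: x + y) z = c * d x z + d y z;
  sipC : forall x y, d y x = conjc (d x y);
  sip_ge0 : forall x, 0 <= d x x
}.

Definition sip_sq (x : U) : R := complex.Re (d x x).

Definition sip_complete : Prop := forall x : nat -> U,
  (forall e : R, 0 < e -> exists N, forall m n, (N <= m)%N -> (N <= n)%N ->
     sip_sq (x m - x n) < e) ->
  exists l, forall e : R, 0 < e -> exists N, forall n, (N <= n)%N ->
     sip_sq (x n - l) < e.

Hypothesis hd : semi_inner_product.

Lemma sip0l z : d 0 z = 0.
Proof. by have := sipP hd (-1) 0 0 z; rewrite scaler0 addr0 mulN1r addNr. Qed.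

Lemma sipZl c x z : d (c *: x) z = c * d x z.
Proof. by rewrite -[c *: x]addr0 sipP // sip0l addr0. Qed.

Lemma sipDl x y z : d (x + y) z = d x z + d y z.
Proof. by rewrite -[x in LHS]scale1r sipP // mul1r. Qed.

Lemma sipNl x z : d (- x) z = - d x z.
Proof. by rewrite -scaleN1r sipZl mulN1r. Qed.

Lemma sipBl x y z : d (x - y) z = d x z - d y z.
Proof. by rewrite sipDl sipNl. Qed.

Lemma sip0r z : d z 0 = 0.
Proof. by rewrite sipC // sip0l conjc0. Qed.

Lemma sipDr x y z : d x (y + z) = d x y + d x z.
Proof. by rewrite sipC // sipDl conjcD -!sipC. Qed.

Lemma sipZr c x y : d x (c *: y) = conjc c * d x y.
Proof. by rewrite sipC // sipZl conjcM -sipC. Qed.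

Lemma sipNr x y : d x (- y) = - d x y.
Proof. by rewrite sipC // sipNl conjcN -sipC. Qed.

Lemma sipBr x y z : d x (y - z) = d x y - d x z.
Proof. by rewrite sipDr sipNr. Qed.

Lemma sip_sqE x : d x x = (sip_sq x)%:C.
Proof. exact/ge0_ReE/sip_ge0. Qed.

Lemma sip_sq_ge0 x : 0 <= sip_sq x.
Proof. by rewrite -ler0c -sip_sqE; apply: sip_ge0. Qed.

Lemma sip_sqZ c x : sip_sq (c *: x) = normc c ^+ 2 * sip_sq x.
Proof.
apply: complexI; rewrite rmorphM /= -!sip_sqE sipZl sipZr -normc_sq.
by rewrite mulrA.
Qed.

Lemma sip_sqD x y :
  sip_sq (x + y) = sip_sq x + sip_sq y + 2 * complex.Re (d x y).
Proof.
rewrite /sip_sq sipDl !sipDr !ReD (sipC hd x y) ReJ; ring.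
Qed.

Lemma sip_sqN x : sip_sq (- x) = sip_sq x.
Proof. by rewrite /sip_sq sipNl sipNr opprK. Qed.

Lemma sip_sqBC x y : sip_sq (x - y) = sip_sq (y - x).
Proof. by rewrite -sip_sqN opprB. Qed.

Lemma sip_CauchySchwarz x y : normc (d x y) ^+ 2 <= sip_sq x * sip_sq y.
Proof.
apply: complex_discriminant; rewrite ?sip_sq_ge0 // => t.
by have := sip_sq_ge0 (x + t *: y); rewrite sip_sqD sip_sqZ sipZr; lra.
Qed.

Lemma sip_parallelogram x y :
  sip_sq (x - y) + 4 * sip_sq (2^-1 *: (x + y)) = 2 * sip_sq x + 2 * sip_sq y.
Proof.
rewrite sip_sqZ sip_sqD sip_sqN sip_sqD sipNr ReN.
have -> : 2^-1 = (2^-1)%:C :> R[i] by rewrite fmorphV /= rmorph_nat.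
by rewrite normc_real ger0_norm ?invr_ge0 //; field.
Qed.

(** Riesz representation for a functional that is only given on a subspace
    (the first projection of the linear relation [L]) and bounded there. The
    vector is the limit of a minimizing sequence of [sip_sq m - 2 Re l] over
    [L], so it lies in the closure of the subspace. The relational form makes
    orthogonal projections and representation theorems instances of the same
    minimization. *)
Lemma sip_riesz (L : U -> R[i] -> Prop) (C : R) : sip_complete ->
  L 0 0 ->
  (forall c m l m' l', L m l -> L m' l' -> L (c *: m + m') (c * l + l')) ->
  0 <= C ->
  (forall m l, L m l -> normc l ^+ 2 <= C * sip_sq m) ->
  exists xi, (forall m l, L m l -> d m xi = l) /\
    forall e : R, 0 < e -> exists m l, L m l /\ sip_sq (xi - m) < e.
Proof.
move=> Ucompl L0 LP C0 LC.
pose J m l := sip_sq m - 2 * complex.Re l.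
pose S : set R := [set r | exists m l, L m l /\ r = J m l].
(* [|l|^2 <= C |m|^2] gives [|m|^2 - 2 |l| >= (|m| - sqrt C)^2 - C]. *)
have Slb : lbound S (- C).
  move=> _ [m [l [Lml ->]]]; rewrite /J.
  have := LC _ _ Lml; have := sip_sq_ge0 m; set s := sip_sq m => s0 h.
  have : complex.Re l ^+ 2 <= C * s.
    by apply: le_trans h; rewrite sqr_normcE lerDl sqr_ge0.
  set a := complex.Re l => h2; rewrite leNgt; apply/negP => h3.
  have : 2 * a > s + C by lra.
  have := sqr_ge0 (s - C); nra.
have Sinf : has_inf S by split; [exists (J 0 0), 0, 0|exists (- C)].
set dd := inf S.
have ddP m l : L m l -> dd <= J m l.
  by move=> Lml; apply: ge_inf; [exists (- C)|exists m, l].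
have [m_ mP] : exists m_ : nat -> U * R[i], forall n,
    L (m_ n).1 (m_ n).2 /\ J (m_ n).1 (m_ n).2 < dd + n.+1%:R^-1.
  suff : forall n, exists p : U * R[i], L p.1 p.2 /\ J p.1 p.2 < dd + n.+1%:R^-1.
    by move=> /choice[f fP]; exists f.
  move=> n; have n0 : 0 < n.+1%:R^-1 :> R by rewrite invr_gt0.
  by have [_ [m [l [Lml ->]]] h] := inf_adherent n0 Sinf; exists (m, l).
have inv_mono N n : (N <= n)%N -> n.+1%:R^-1 <= N.+1%:R^-1 :> R.
  by move=> ?; rewrite lef_pV2 ?posrE ?ltr0n // ler_nat ltnS.
have inv_small (e : R) : 0 < e -> exists N : nat, N.+1%:R^-1 < e.
  move=> e0; exists (Num.truncn e^-1).
  by rewrite -[ltRHS]invrK ltf_pV2 ?posrE ?ltr0n ?invr_gt0 // truncnS_gt.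
have [xi xiP] : exists l, forall e : R, 0 < e -> exists N, forall n, (N <= n)%N ->
    sip_sq ((m_ n).1 - l) < e.
  apply: (Ucompl) => e e0.
  have [N hN] : exists N : nat, N.+1%:R^-1 < e / 4 by apply: inv_small; lra.
  exists N => a b Na Nb; have [La Ja] := mP a; have [Lb Jb] := mP b.
  (* The midpoint of two almost minimizers cannot be much better than they are. *)
  have := sip_parallelogram (m_ a).1 (m_ b).1.
  have Lm : L (2^-1 *: ((m_ a).1 + (m_ b).1)) (2^-1 * ((m_ a).2 + (m_ b).2)).
    rewrite scalerDr mulrDr; apply: (LP) => //.
    by rewrite -[_ *: _]addr0 -[X in L _ X]addr0; apply: LP.
  have := ddP _ _ Lm; rewrite /J in Ja Jb *.
  have -> : 2^-1 = (2^-1)%:C :> R[i] by rewrite fmorphV /= rmorph_nat.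
  rewrite ReZ ReD; have := inv_mono _ _ Na; have := inv_mono _ _ Nb.
  move: hN Ja Jb.
  set ia := a.+1%:R^-1; set ib := b.+1%:R^-1; set iN := N.+1%:R^-1.
  by lra.
exists xi; split; last first.
  move=> e /xiP[N /(_ _ (leqnn N)) hN].
  by exists (m_ N).1, (m_ N).2; split; [case: (mP N)|rewrite sip_sqBC].
move=> m l Lml.
suff : d xi m - conjc l = 0.
  by move/subr0_eq => h; rewrite sipC // h conjcK.
apply: normc_eq0P => e e0.
have sm0 := sip_sq_ge0 m; set s := sip_sq m in sm0.
have e'0 : 0 < e / (4 * (s + 1)) by rewrite divr_gt0 //; lra.
have [N1 hN1] := inv_small _ e'0; have [N2 hN2] := xiP _ e'0.
pose n := maxn N1 N2; have [Ln Jn] := mP n.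
have close := hN2 n (leq_maxr _ _).
(* Moving the almost minimizer by [t m] cannot improve it by more than its
   distance to the infimum: a quadratic inequality in [t]. *)
have h1 : normc (d (m_ n).1 m - conjc l) ^+ 2 <= (J (m_ n).1 (m_ n).2 - dd) * s.
  apply: complex_discriminant => //; first by rewrite subr_ge0 ddP.
  move=> t; have := ddP _ _ (LP t _ _ _ _ Lml Ln).
  rewrite /J sip_sqD sip_sqZ sipZl mulrBr ReB ReD -(ReJ (t * l)) conjcM.
  by rewrite -(ReJ (t * d _ _)) conjcM -sipC // -/s; lra.
have h2 := sip_CauchySchwarz ((m_ n).1 - xi) m.
have h3 : J (m_ n).1 (m_ n).2 - dd <= e / (4 * (s + 1)).
  apply/ltW; rewrite ltrBlDl; apply: lt_le_trans Jn _; rewrite lerD2l.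
  exact: le_trans (inv_mono _ _ (leq_maxl N1 N2)) (ltW hN1).
have -> : d xi m - conjc l = (d (m_ n).1 m - conjc l) + - d ((m_ n).1 - xi) m.
  by rewrite sipBl; ring.
apply: le_trans (normc_sqD _ _) _; rewrite normcN.
have h4 : e / (4 * (s + 1)) * s <= e / 4.
  rewrite invfM mulrA -[leRHS]mulr1 -mulrA ler_wpM2l //; first by lra.
  by rewrite mulrC ler_pdivrMr; lra.
have h5 : sip_sq ((m_ n).1 - xi) * s <= e / (4 * (s + 1)) * s.
  by rewrite ler_wpM2r // ltW.
have h6 : (J (m_ n).1 (m_ n).2 - dd) * s <= e / (4 * (s + 1)) * s.
  by rewrite ler_wpM2r.
by rewrite -/s in h2; lra.
Qed.

Lemma sip_ext x y : (forall z, sip_sq z = 0 -> z = 0) ->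
  (forall z, d x z = d y z) -> x = y.
Proof.
move=> def h; apply/subr0_eq/def; rewrite /sip_sq.
by rewrite sipBl h subrr.
Qed.

Record closed_subspace (M : U -> Prop) : Prop := {
  csub0 : M 0;
  csubP : forall c x y, M x -> M y -> M (c *: x + y);
  csub_closed : forall x, (forall e : R, 0 < e -> exists2 m, M m & sip_sq (x - m) < e) -> M x
}.

Record orthogonal_projection (M : U -> Prop) (P : U -> U) : Prop := {
  projP : linear P;
  proj_in : forall x, M (P x);
  proj_dot : forall x m, M m -> d (P x) m = d x m;
  proj_le : forall x, sip_sq (P x) <= sip_sq x;
  proj_id : forall x, M x -> P x = x
}.

(** The projection of [x] represents the functional [m |-> <m, x>] on [M]. *)
Lemma sip_projection (M : U -> Prop) :
  sip_complete -> (forall z, sip_sq z = 0 -> z = 0) -> closed_subspace M ->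
  exists P, orthogonal_projection M P.
Proof.
move=> Ucompl def [M0 MP Mcl].
have /choice[P PP] : forall x, exists y, M y /\ forall m, M m -> d y m = d x m.
  move=> x.
  have [|||| y [yP ycl]] := @sip_riesz (fun m l => M m /\ l = d m x) (sip_sq x) Ucompl.
  - by rewrite sip0l.
  - by move=> c m l m' l' [Mm ->] [Mm' ->]; split; [exact: MP|rewrite sipP].
  - exact: sip_sq_ge0.
  - by move=> m l [_ ->]; rewrite mulrC sip_CauchySchwarz.
  exists y; split=> [|m Mm]; last by rewrite sipC // (yP m (d m x)) // -sipC.
  by apply: Mcl => e /ycl[m [l [[Mm _] h]]]; exists m.
have PM x : M (P x) by case: (PP x).
have PD x m : M m -> d (P x) m = d x m by case: (PP x) => _; apply.
have MB x y : M x -> M y -> M (x - y).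
  by move=> Mx My; rewrite addrC -scaleN1r; apply: (MP).
have uniq x y : M x -> M y -> (forall m, M m -> d x m = d y m) -> x = y.
  move=> Mx My h; apply/subr0_eq/def; rewrite /sip_sq sipBl h ?subrr //.
  exact: MB.
exists P; split=> //.
- move=> c x y; apply: uniq => //; first exact: MP.
  by move=> m Mm; rewrite sipP // !PD // sipP.
- move=> x; have -> : sip_sq x = sip_sq (P x + (x - P x)).
    by rewrite addrC subrK.
  rewrite sip_sqD sipBr (sipC hd x) -(PD x) // -sipC // subrr.
  by rewrite mulr0 addr0 lerDl sip_sq_ge0.
- by move=> x Mx; apply: uniq => // m; apply: PD.
Qed.

End SemiInnerProduct.

(** * Bounded operators on Hilbert spaces *)

Section Hilbert.
Context {R : realType}.
Implicit Types (V : hilbertType R).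

Lemma rnormE (V : normedModType R[i]) (x : V) : `|x| = (rnorm x)%:C.
Proof. exact/ge0_ReE/normr_ge0. Qed.

Lemma rnorm_ge0 (V : normedModType R[i]) (x : V) : 0 <= rnorm x.
Proof. by rewrite -ler0c -rnormE. Qed.

Lemma rnormZ (V : normedModType R[i]) c (x : V) : rnorm (c *: x) = normc c * rnorm x.
Proof. by apply: complexI; rewrite rmorphM /= -!rnormE normrZ. Qed.

Lemma rnorm0 (V : normedModType R[i]) : rnorm (0 : V) = 0.
Proof. by rewrite /rnorm normr0. Qed.

Lemma rnorm_eq0 (V : normedModType R[i]) (x : V) : rnorm x = 0 -> x = 0.
Proof. by move=> h; apply/eqP; rewrite -normr_eq0 rnormE h. Qed.

Lemma hdot_sip V : semi_inner_product (@hdot R V).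
Proof.
split=> [c x y z|x y|x].
- by rewrite linearPl.
- by rewrite hermC expr0 mul1r.
- exact: dnorm_ge0.
Qed.

Lemma hdot_sq V (x : V) : hdot x x = (rnorm x ^+ 2)%:C.
Proof. by rewrite hdot_norm rnormE rmorphXn. Qed.

Lemma hdot_sip_sq V (x : V) : sip_sq (@hdot R V) x = rnorm x ^+ 2.
Proof. by rewrite /sip_sq hdot_sq. Qed.

Lemma hdot_CS V (x y : V) : normc (hdot x y) <= rnorm x * rnorm y.
Proof.
rewrite -(@ler_pXn2r _ 2) ?nnegrE ?mulr_ge0 ?rnorm_ge0 ?normc_ge0 // exprMn -!hdot_sip_sq.
exact: sip_CauchySchwarz (hdot_sip V) _ _.
Qed.

Lemma hdot_definite V (x : V) : sip_sq (@hdot R V) x = 0 -> x = 0.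
Proof. by rewrite hdot_sip_sq => /eqP; rewrite sqrf_eq0 => /eqP/rnorm_eq0. Qed.

Lemma hdot_ext V (x y : V) : (forall z, hdot x z = hdot y z) -> x = y.
Proof. by move=> h; apply: (sip_ext (hdot_sip V)) => //; apply: hdot_definite. Qed.

Lemma lt_sqr_sqrt (a e : R) : 0 <= a -> 0 < e -> a < Num.sqrt e -> a ^+ 2 < e.
Proof.
by move=> a0 e0 h; rewrite -[ltRHS]sqr_sqrtr ?ltW // ltr_pXn2r ?nnegrE ?sqrtr_ge0.
Qed.

Lemma hdot_complete V : sip_complete (@hdot R V).
Proof.
move=> x xC.
have : cauchy_ex (x @ \oo).
  move=> eps eps0; have := eps0; rewrite ltcE => /andP[/eqP i0 r0].
  have epsE : eps = (complex.Re eps)%:C by apply/ge0_ReE/ltW.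
  set e := complex.Re eps in r0 epsE.
  have [|N hN] := xC (e ^+ 2); first by rewrite exprn_gt0.
  exists (x N); exists N => // n /= Nn.
  rewrite -ball_normE /= rnormE epsE ltcR.
  have := hN N n (leqnn _) Nn; rewrite hdot_sip_sq.
  by rewrite ltr_pXn2r // nnegrE ?rnorm_ge0 ?ltW.
move=> /cauchyP /cauchy_cvgP /= xl.
exists (lim (x @ \oo)) => e e0.
have e0' : 0 < (Num.sqrt e)%:C by rewrite ltcR sqrtr_gt0.
have /cvgrPdist_lt /(_ _ e0') := xl.
move=> [N _ hN]; exists N => n Nn; have := hN n Nn.
rewrite rnormE ltcR => h; rewrite (sip_sqBC (hdot_sip V)) hdot_sip_sq.
exact: lt_sqr_sqrt (rnorm_ge0 _) e0 h.
Qed.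

Lemma linear0E V (T : V -> V) : linear T -> T 0 = 0.
Proof. by move=> h; have /= := h (-1) 0 0; rewrite scaler0 addr0 scaleN1r addNr. Qed.

Lemma linearZE V (T : V -> V) c x : linear T -> T (c *: x) = c *: T x.
Proof. by move=> h; have /= := h c x 0; rewrite (linear0E h) !addr0. Qed.

Lemma linearDE V (T : V -> V) x y : linear T -> T (x + y) = T x + T y.
Proof. by move=> h; have /= := h 1 x y; rewrite !scale1r. Qed.

Lemma linear_sumE V (T : V -> V) I (r : seq I) (F : I -> V) : linear T ->
  T (\sum_(i <- r) F i) = \sum_(i <- r) T (F i).
Proof.
move=> h; elim: r => [|i r IH]; first by rewrite !big_nil (linear0E h).
by rewrite !big_cons (linearDE _ _ h) IH.
Qed.

Lemma bounded_opP V (T : V -> V) : bounded_op T <->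
  linear T /\ exists2 C, 0 <= C & forall x, rnorm (T x) <= C * rnorm x.
Proof.
split=> [[linT cT]|[linT [C C0 hC]]]; split=> //.
  pose f : {linear V -> V} := HB.pack T (GRing.isLinear.Build _ _ _ _ T linT).
  have : bounded_near f (nbhs 0) by apply/linear_bounded_continuous.
  move=> /linear_boundedP/pinfty_ex_gt0[r r0 hr].
  exists (complex.Re r); first by rewrite -ler0c -ge0_ReE // ltW.
  move=> x; have := hr x; rewrite !rnormE (ge0_ReE (ltW r0)) -rmorphM.
  by rewrite /= lecR.
pose f : {linear V -> V} := HB.pack T (GRing.isLinear.Build _ _ _ _ T linT).
apply: (@bounded_linear_continuous _ _ _ f); apply/bounded_funP => r.
exists (C%:C * r) => x xr; rewrite rnormE.
apply: le_trans (_ : C%:C * `|x| <= _); last by rewrite ler_wpM2l // ler0c.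
by rewrite rnormE -rmorphM /= lecR; apply: hC.
Qed.

Lemma hilbert_riesz V (f : V -> R[i]) (C : R) :
  (forall c x y, f (c *: x + y) = c * f x + f y) -> 0 <= C ->
  (forall x, normc (f x) <= C * rnorm x) ->
  exists z, forall x, f x = hdot x z.
Proof.
move=> flin C0 fC.
have f0 : f 0 = 0.
  by have := flin (-1) 0 0; rewrite scaler0 addr0 mulN1r addNr.
have [|||| z [zP _]] := @sip_riesz _ _ _ (hdot_sip V) (fun m l => l = f m) (C ^+ 2)
    (@hdot_complete V).
- by rewrite f0.
- by move=> c m l m' l' -> ->; rewrite flin.
- exact: sqr_ge0.
- move=> m l ->; rewrite hdot_sip_sq -exprMn ler_pXn2r ?nnegrE ?normc_ge0 //.
  by rewrite mulr_ge0 ?rnorm_ge0.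
by exists z => x; rewrite (zP x (f x)).
Qed.

(** All the operators below are built from their forms by this lemma: adjoints,
    the transports of the spectrum to other representations, and the adjoint of
    the map [j] of the theorem. *)
Lemma sesqui_riesz V (D : V -> V -> R[i]) (C : R) :
  (forall c x y z, D (c *: x + y) z = c * D x z + D y z) ->
  (forall c x y z, D x (c *: y + z) = conjc c * D x y + D x z) ->
  0 <= C -> (forall x y, normc (D x y) <= C * (rnorm x * rnorm y)) ->
  exists S : V -> V, [/\ linear S, (forall x y, hdot (S x) y = D x y) &
    forall x, rnorm (S x) <= C * rnorm x].
Proof.
move=> Dl Dr C0 DC.
have /choice[S SP] : forall x, exists z, forall y, hdot z y = D x y.
  move=> x; have [|||z zP] := @hilbert_riesz V (fun y => conjc (D x y)) (C * rnorm x).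
  - by move=> c y z; rewrite Dr conjcD conjcM conjcK.
  - by rewrite mulr_ge0 ?rnorm_ge0.
  - by move=> y; rewrite normc_conj -mulrA.
  by exists z => y; rewrite (sipC (hdot_sip V)) -zP conjcK.
exists S; split=> // [c x y|x].
  by apply: hdot_ext => z; rewrite (sipP (hdot_sip V)) !SP Dl.
have := DC x (S x); rewrite -SP hdot_sq normc_real ger0_norm ?sqr_ge0 //.
rewrite expr2 !mulrA; have [->|h] := eqVneq (rnorm (S x)) 0.
  by rewrite mulr_ge0 ?rnorm_ge0.
by rewrite ler_pM2r // lt_neqAle eq_sym h rnorm_ge0.
Qed.

Lemma adjoint_exists V (T : V -> V) : bounded_op T ->
  exists2 S, bounded_op S & adjoint_of T S.
Proof.
move=> /bounded_opP[linT [C C0 hC]].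
have [|||| S [Slin SP SC]] := @sesqui_riesz V (fun x y => hdot x (T y)) C.
- by move=> c x y z; rewrite (sipP (hdot_sip V)).
- by move=> c x y z; rewrite linT (sipDr (hdot_sip V)) (sipZr (hdot_sip V)).
- by [].
- move=> x y; apply: le_trans (hdot_CS _ _) _.
  by rewrite mulrCA ler_wpM2l ?rnorm_ge0.
exists S; first by apply/bounded_opP; split=> //; exists C.
by move=> x y; rewrite (sipC (hdot_sip V)) -SP -(sipC (hdot_sip V)).
Qed.

Lemma adjoint_sym V (T S : V -> V) : adjoint_of T S -> adjoint_of S T.
Proof. by move=> h x y; rewrite (sipC (hdot_sip V)) -h -(sipC (hdot_sip V)). Qed.

End Hilbert.

(** * The von Neumann algebra of a unitary representation *)

Section HilbertPower.
Context {R : realType} {V : hilbertType R} {n : nat}.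
Implicit Types x y : 'I_n -> V.

Definition hdotn x y : R[i] := \sum_i hdot (x i) (y i).

Lemma hdotn_sip : semi_inner_product hdotn.
Proof.
split=> [c x y z|x y|x].
- rewrite /hdotn mulr_sumr -big_split; apply: eq_bigr => i _.
  exact: (sipP (hdot_sip V)).
- rewrite /hdotn conjc_sum; apply: eq_bigr => i _.
  exact: (sipC (hdot_sip V)).
- by apply: sumr_ge0 => i _; apply: (sip_ge0 (hdot_sip V)).
Qed.

Lemma hdotn_sq x : sip_sq hdotn x = \sum_i rnorm (x i) ^+ 2.
Proof.
apply: complexI; rewrite rmorph_sum /= -(sip_sqE hdotn_sip).
by apply: eq_bigr => i _; rewrite hdot_sq.
Qed.

Lemma rnorm_le_hdotn x i : rnorm (x i) ^+ 2 <= sip_sq hdotn x.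
Proof.
rewrite hdotn_sq (bigD1 i) //= lerDl.
by apply: sumr_ge0 => j _; apply: sqr_ge0.
Qed.

Lemma hdotn_definite x : sip_sq hdotn x = 0 -> x = 0.
Proof.
move=> h; apply/funext => i; apply: rnorm_eq0; apply/eqP.
rewrite -sqrf_eq0 eq_le sqr_ge0 andbT -h; exact: rnorm_le_hdotn.
Qed.

Lemma hdotn_complete : sip_complete hdotn.
Proof.
move=> x xC.
have /choice[l lP] : forall i, exists l, forall e : R, 0 < e -> exists N, forall k,
    (N <= k)%N -> sip_sq (@hdot R V) (x k i - l) < e.
  move=> i; apply: hdot_complete => e /xC[N hN]; exists N => a b Na Nb.
  rewrite hdot_sip_sq; apply: le_lt_trans (hN a b Na Nb).
  exact: (rnorm_le_hdotn (x a - x b) i).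
exists l => e e0.
have e'0 : 0 < e / n.+1%:R by rewrite divr_gt0.
have /choice[N NP] : forall i, exists N, forall k, (N <= k)%N ->
    sip_sq (@hdot R V) (x k i - l i) < e / n.+1%:R.
  by move=> i; apply: lP.
exists (\max_i N i)%N => k Nk.
apply: (@le_lt_trans _ _ (\sum_(i < n) (e / n.+1%:R))).
  rewrite hdotn_sq; apply: ler_sum => i _.
  rewrite -hdot_sip_sq; apply/ltW/NP; apply: leq_trans Nk.
  exact: leq_bigmax.
rewrite sumr_const card_ord -[ltLHS]mulr_natr -mulrA gtr_pMr //.
by rewrite mulrC ltr_pdivrMr // mul1r ltr_nat.
Qed.

End HilbertPower.

Section VonNeumann.
Context {R : realType}.
Implicit Types V : hilbertType R.

Lemma commutant_bounded V (X : set (V -> V)) T : commutant X T -> bounded_op T.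
Proof. by case. Qed.

Lemma sub_commutant V (X Y : set (V -> V)) : X `<=` Y -> commutant Y `<=` commutant X.
Proof. by move=> XY T [bT h]; split=> // S /XY; apply: h. Qed.

Lemma sub_bicommutant V (X : set (V -> V)) : X `<=` (@bounded_op R V) ->
  X `<=` commutant (commutant X).
Proof. by move=> Xb T XT; split=> [|S [_ h]]; [exact: Xb|rewrite h]. Qed.

Lemma commutant_adjoint V (X : set (V -> V)) :
  (forall T, X T -> exists2 S, adjoint_of T S & X S) ->
  forall T, commutant X T -> exists2 S, adjoint_of T S & commutant X S.
Proof.
move=> Xadj T [bT hT]; have [S bS TS] := adjoint_exists bT.
exists S => //; split=> // Q XQ; have [Q' QQ' XQ'] := Xadj Q XQ.
have TQ' x : T (Q' x) = Q' (T x) by exact: (congr1 (@^~ x) (hT _ XQ')).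
apply/funext => x; apply: hdot_ext => y /=.
rewrite (adjoint_sym TS) QQ' -TQ' -(adjoint_sym TS).
by rewrite -QQ'.
Qed.

Section Rep.
Context {G : topologicalGroupType} {V : hilbertType R} (pi : unitary_rep G V).

Lemma rep_mulE s t x : pi (s * t)%g x = pi s (pi t x).
Proof. by rewrite repM. Qed.

Lemma rep1E x : pi 1%g x = x.
Proof. by rewrite rep1. Qed.

Lemma rep_adjoint s : adjoint_of (pi s) (pi s^-1%g).
Proof.
by move=> x y; rewrite -(rep_unitary pi s x) -rep_mulE mulgV rep1E.
Qed.

Lemma rep_rnorm s x : rnorm (pi s x) = rnorm x.
Proof.
apply/eqP; rewrite -(@eqrXn2 _ 2) ?rnorm_ge0 //; apply/eqP; apply: complexI.
by rewrite -!hdot_sq rep_unitary.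
Qed.

Lemma rep_bounded s : bounded_op (pi s).
Proof.
apply/bounded_opP; split; first exact: rep_linear.
by exists 1 => // x; rewrite mul1r rep_rnorm.
Qed.

Lemma range_rep_adjoint T : range pi T -> exists2 S, adjoint_of T S & range pi S.
Proof. by move=> [s _ <-]; exists (pi s^-1%g); [exact: rep_adjoint|exists s^-1%g]. Qed.

Lemma range_rep_bounded : range pi `<=` @bounded_op R V.
Proof. by move=> _ [s _ <-]; apply: rep_bounded. Qed.

(** The bicommutant is itself a von Neumann algebra, so it is the least one that
    contains the group. *)
Lemma rep_vNA_bicommutant : rep_vNA pi = commutant (commutant (range pi)).
Proof.
apply/seteqP; split=> T.
  apply; last exact: sub_bicommutant range_rep_bounded.
  split.
    by apply/commutant_adjoint/commutant_adjoint/range_rep_adjoint.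
  apply/seteqP; split; last first.
    by apply: sub_bicommutant => S; apply: commutant_bounded.
  by apply/sub_commutant/sub_bicommutant => S; apply: commutant_bounded.
move=> hT M [Madj MM] piM; rewrite -MM.
by apply: (sub_commutant (sub_commutant piM)) hT.
Qed.

(** This is the form of von Neumann's density theorem that is needed below: it
    makes functionals on the algebra depend only on their values on the group.
    The vectors [w] whose functional [sum <. w_i, y_i>] vanishes on the group form
    a closed invariant subspace of the [n]-fold Hilbert sum, so the matrix
    entries of the projection onto it lie in the commutant; hence [T] leaves
    this subspace invariant. *)
Lemma rep_vNA_functional_eq0 T n (x y : 'I_n -> V) : rep_vNA pi T ->
  (forall s, \sum_i hdot (pi s (x i)) (y i) = 0) ->
  \sum_i hdot (T (x i)) (y i) = 0.
Proof.
rewrite rep_vNA_bicommutant => -[bT hT] xy0.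
have /bounded_opP[linT _] := bT.
pose D := hdot_sip V; pose Dn := @hdotn_sip R V n.
pose M (w : 'I_n -> V) := forall s, \sum_i hdot (pi s (w i)) (y i) = 0.
pose act s (w : 'I_n -> V) := fun i => pi s (w i).
have actP s c v w : act s (c *: v + w) = c *: act s v + act s w.
  by apply/funext => i; rewrite /act /= -[RHS]rep_linear.
have act_dot s v w : hdotn (act s v) w = hdotn v (act s^-1%g w).
  by apply: eq_bigr => i _; apply: rep_adjoint.
have act_sq s w : sip_sq hdotn (act s w) = sip_sq hdotn w.
  by rewrite !hdotn_sq; apply: eq_bigr => i _; rewrite /act rep_rnorm.
have ME w s : \sum_i hdot (pi s (w i)) (y i) = hdotn (act s w) y by [].
have Mcl : closed_subspace hdotn M.
  split.
  - move=> s; rewrite big1 // => i _; rewrite (linear0E (rep_linear pi s)).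
    by rewrite (sip0l D).
  - move=> c v w Mv Mw s; rewrite ME actP (sipP Dn) -!ME Mv Mw.
    by rewrite mulr0 addr0.
  - move=> w hw s; rewrite ME; apply: normc_eq0P => e e0.
    have Y0 := sip_sq_ge0 Dn y; set Y := sip_sq hdotn y in Y0.
    have e'0 : 0 < e / (Y + 1) by rewrite divr_gt0 //; lra.
    have [m Mm hm] := hw _ e'0.
    have -> : hdotn (act s w) y = hdotn (act s (w - m)) y.
      have -> : w - m = -1 *: m + w by rewrite scaleN1r addrC.
      by rewrite actP (sipP Dn) -(ME m) Mm mulr0 add0r.
    apply: le_trans (sip_CauchySchwarz Dn _ _) _; rewrite act_sq -/Y.
    apply: (@le_trans _ _ (e / (Y + 1) * Y)); first by rewrite ler_wpM2r // ltW.
    by rewrite mulrAC ler_pdivrMr ?ler_pM2l //; lra.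
have Mact s w : M w -> M (act s w).
  move=> Mw t; rewrite -[RHS](Mw (t * s)%g); apply: eq_bigr => i _.
  by rewrite /act rep_mulE.
have [P [Plin PM PD Ple Pid]] := sip_projection Dn (@hdotn_complete R V n)
  (@hdotn_definite R V n) Mcl.
have Pact s w : P (act s w) = act s (P w).
  apply/subr0_eq/hdotn_definite; set u := _ - _.
  have Mu : M u.
    rewrite /u addrC -scaleN1r; apply: (csubP Mcl); last exact: PM.
    exact/Mact/PM.
  rewrite /sip_sq {1}/u (sipBl Dn) PD // !act_dot PD ?subrr //.
  exact: Mact.
pose inj (j : 'I_n) (v : V) : 'I_n -> V := fun i => if i == j then v else 0.
have inj_lin j c u v : inj j (c *: u + v) = c *: inj j u + inj j v.
  apply/funext => i; rewrite /inj /=; change ((if i == j then c *: u + v else 0) =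
    c *: (if i == j then u else 0) + (if i == j then v else 0)).
  by case: eqP; rewrite ?scaler0 ?addr0.
have inj_act j s v : inj j (pi s v) = act s (inj j v).
  apply/funext => i; rewrite /inj /act; case: eqP => // _.
  by rewrite (linear0E (rep_linear pi s)).
have inj_sq j v : sip_sq hdotn (inj j v) = rnorm v ^+ 2.
  rewrite hdotn_sq (bigD1 j) //= /inj eqxx big1 ?addr0 // => i /negPf ->.
  by rewrite rnorm0 expr0n.
have sum_inj (w : 'I_n -> V) : w = \sum_j inj j (w j).
  apply/funext => i; rewrite fct_sumE (bigD1 i) //= /inj eqxx big1 ?addr0 //.
  by move=> j /negPf; rewrite eq_sym => ->.
have Psum (F : 'I_n -> 'I_n -> V) : P (\sum_j F j) = \sum_j P (F j).
  pose Pl : {linear ('I_n -> V) -> ('I_n -> V)} :=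
    HB.pack P (GRing.isLinear.Build _ _ _ _ P Plin).
  exact: (raddf_sum Pl).
(* The matrix entries of [P] are in the commutant. *)
have PT i j v : T (P (inj j v) i) = P (inj j (T v)) i.
  apply: (congr1 (@^~ v) (hT (fun v => P (inj j v) i) _)); split.
    apply/bounded_opP; split=> [c u w|]; first by rewrite inj_lin Plin.
    exists 1 => // u; rewrite mul1r -(@ler_pXn2r _ 2) ?nnegrE ?rnorm_ge0 //.
    by apply: le_trans (rnorm_le_hdotn _ i) _; rewrite -(inj_sq j).
  by move=> _ [s _ <-]; apply/funext => u /=; rewrite inj_act Pact.
have xM : M x by [].
have TM : P (fun i => T (x i)) = fun i => T (x i).
  rewrite [X in P X]sum_inj Psum -[in RHS](Pid x) // [in RHS](sum_inj x) Psum.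
  apply/funext => i; rewrite !fct_sumE linear_sumE //; apply: eq_bigr => j _.
  by rewrite PT.
have := PM (fun i => T (x i)); rewrite TM => /(_ 1%g) h; rewrite -[RHS]h.
by apply: eq_bigr => i _; rewrite rep1E.
Qed.

End Rep.
End VonNeumann.

(** * Continuity of coefficient functions *)

Section Coefficients.
Context {R : realType}.

Lemma cvg_normcP T (F : set_system T) (FF : Filter F) (f : T -> R[i]^o) (l : R[i]^o) :
  f @ F --> l <-> forall e : R, 0 < e -> \forall t \near F, normc (l - f t : R[i]) < e.
Proof.
split=> [/cvgrPdist_lt h e e0|h].
  have e0' : 0 < e%:C by rewrite ltcR.
  by apply: filterS (h _ e0') => t; rewrite (_ : `|_| = (normc (l - f t : R[i]))%:C) // ltcR.
apply/cvgrPdist_lt => e e0; have := e0; rewrite ltcE => /andP[_ r0].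
have eE : e = (complex.Re e)%:C by apply/ge0_ReE/ltW.
apply: filterS (h _ r0) => t ht.
by rewrite eE (_ : `|_| = (normc (l - f t : R[i]))%:C) // ltcR.
Qed.

Context {G : topologicalGroupType} {V : hilbertType R} (pi : unitary_rep G V).

Lemma coef_continuous x y : continuous (coef pi x y : G -> R[i]^o).
Proof.
move=> s; apply/cvg_normcP => r r0.
have y0 := rnorm_ge0 y.
have e'0 : 0 < (r / (rnorm y + 1))%:C by rewrite ltcR divr_gt0 //; lra.
have /cvgrPdist_lt/(_ _ e'0) := @rep_continuous _ _ _ pi x s.
apply: filterS => t; rewrite rnormE ltcR => h.
rewrite /coef -(sipBl (hdot_sip V)); apply: le_lt_trans (hdot_CS _ _) _.
apply: (@le_lt_trans _ _ (r / (rnorm y + 1) * rnorm y)).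
  by rewrite ler_wpM2r // ltW.
by rewrite mulrAC ltr_pdivrMr ?ltr_pM2l //; lra.
Qed.

End Coefficients.

(** * Positive definite matrices of functions *)

Section PositiveDefinite.
Context {R : realType} {H : topologicalGroupType}.

(** An item [(c, (s, i))] of [f] or [g] stands for the vector [c pi(s) x_i], where
    [p i j] is thought of as the coefficient of [x_i] and [x_j]. *)
Definition pd_form (I : Type) (p : I -> I -> H -> R[i])
    (f g : seq (R[i] * (H * I))) : R[i] :=
  \sum_(a <- f) \sum_(b <- g)
    a.1 * conjc b.1 * p a.2.2 b.2.2 (b.2.1^-1 * a.2.1)%g.

Definition matrix_positive_definite (I : Type) (p : I -> I -> H -> R[i]) : Prop :=
  forall f, 0 <= pd_form p f f.

Lemma pd_form_catl (I : Type) (p : I -> I -> H -> R[i]) f f' g :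
  pd_form p (f ++ f') g = pd_form p f g + pd_form p f' g.
Proof. by rewrite /pd_form big_cat. Qed.

Lemma pd_form_catr (I : Type) (p : I -> I -> H -> R[i]) f g g' :
  pd_form p f (g ++ g') = pd_form p f g + pd_form p f g'.
Proof.
by rewrite /pd_form -big_split; apply: eq_bigr => a _; rewrite big_cat.
Qed.

Lemma pd_form_B (I : Type) (p q : I -> I -> H -> R[i]) f g :
  pd_form (fun i j s => p i j s - q i j s) f g = pd_form p f g - pd_form q f g.
Proof.
rewrite /pd_form -sumrB; apply: eq_bigr => a _.
by rewrite -sumrB; apply: eq_bigr => b _; rewrite mulrBr.
Qed.

Lemma matrix_pd_diag (I : Type) (p : I -> I -> H -> R[i]) i :
  matrix_positive_definite p -> positive_definite (p i i).
Proof.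
move=> h n c s; have := h [seq (c k, (s k, i)) | k <- enum 'I_n].
rewrite /pd_form big_map big_enum /=; congr (0 <= _).
by apply: eq_bigr => k _; rewrite big_map big_enum.
Qed.

(** Expand the form, which is real, at [s x_i + c x_j] for [c = 1] and [c = i]. *)
Lemma matrix_pd_sym (I : Type) (p : I -> I -> H -> R[i]) i j s :
  matrix_positive_definite p -> p i j s = conjc (p j i s^-1%g).
Proof.
move=> h.
have h1 k : complex.Im (p k k 1%g) = 0.
  apply: ger0_Im; have := h [:: (1, (1%g, k))].
  by rewrite /pd_form !big_seq1; cbn [fst snd]; rewrite conjc1 !mul1r invg1 mulg1.
have h2 c : complex.Im (conjc c * p i j s + c * p j i s^-1%g) = 0.
  have := ger0_Im (h [:: (1, (s, i)); (c, (1%g, j))]).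
  rewrite /pd_form !big_cons !big_nil; cbn [fst snd].
  rewrite conjc1 !mul1r !addr0 invg1 !mul1g !mulg1 mulVg.
  rewrite mulr1 normc_sq.
  move: (h1 i) (h1 j); case: (p i i _) => a1 a2; case: (p j j _) => b1 b2 /= -> ->.
  case: (conjc c * _) => x1 x2; case: (c * _) => y1 y2 /=.
  by rewrite mulr0 mul0r !addr0 add0r.
move: (h2 1) (h2 'i); case: (p i j s) => a b; case: (p j i _) => a' b' /=.
move=> e1 e2.
by apply/eqP; rewrite eq_complex /=; apply/andP; split; apply/eqP; lra.
Qed.

(** Apart from rescaling to [q 1 = 1], the case [q 1 = 0] is to be dealt with:
    positivity on two points then forces [q = 0]. *)
Lemma universal_vector (W : hilbertType R) (om : unitary_rep H W) (q : H -> R[i]) :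
  universal_rep om -> continuous (q : H -> R[i]^o) -> positive_definite q ->
  exists w, coef om w w = q.
Proof.
move=> [x [xp _ _]] qc qpd.
have {}qpd n (c : 'I_n -> R[i]) (s : 'I_n -> H) :
    0 <= \sum_i \sum_j c i * conjc (c j) * q ((s j)^-1 * s i)%g := qpd n c s.
have q1 : 0 <= q 1%g.
  have := qpd 1 (fun=> 1) (fun=> 1%g).
  by rewrite !big_ord1; cbn beta; rewrite conjc1 !mul1r invg1 mulg1.
have [q0|q0] := eqVneq (q 1%g) 0.
  exists 0; apply/funext => s; rewrite /coef (sip0r (hdot_sip W)).
  have h c : 0 <= conjc c * q s + c * q s^-1%g.
    have := qpd 2 (fun i => if i == ord0 then 1 else c) (fun i => if i == ord0 then s else 1%g).
    have E : (lift ord0 ord0 == ord0 :> 'I_2) = false by [].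
    rewrite !big_ord_recl !big_ord0; cbn beta.
    rewrite E eqxx conjc1 !mul1r !addr0 invg1 !mul1g !mulg1 mulVg.
    by rewrite q0 !mulr0 !addr0 add0r mulr1.
  move: (h 1) (h (-1)) (h 'i) (h (- 'i)); case: (q s) => a b; case: (q _) => a' b'.
  rewrite !lecE /= => /andP[/eqP e1 e2] /andP[/eqP e3 e4] /andP[/eqP e5 e6] /andP[/eqP e7 e8].
  by apply/eqP; rewrite eq_complex /=; apply/andP; split; apply/eqP; lra.
have q1E := ge0_ReE q1; set r := complex.Re _ in q1E.
have r0 : 0 < r by rewrite lt_neqAle -ler0c -q1E q1 andbT -(inj_eq (@complexI R)) -q1E eq_sym.
have hp : normalized_pd (fun s => (r%:C)^-1 * q s).
  split.
  - move=> s; apply/cvg_normcP => e e0.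
    have /cvg_normcP/(_ (r * e)) : q @ s --> (q s : R[i]^o) by apply: qc.
    rewrite mulr_gt0 // => /(_ isT); apply: filterS => t.
    rewrite -mulrBr normcM normcV normc_real gtr0_norm //.
    by rewrite ltr_pdivrMl.
  - move=> n c s; have := qpd n c s => h.
    rewrite (_ : \sum_(i < n) _ = (\sum_i \sum_j c i * conjc (c j) * q ((s j)^-1 * s i)%g) / r%:C).
      by rewrite divr_ge0 // ler0c ltW.
    rewrite mulr_suml; apply: eq_bigr => i _; rewrite mulr_suml; apply: eq_bigr => j _.
    by rewrite mulrCA mulrC.
  - by rewrite -q1E mulVf.
exists ((Num.sqrt r)%:C *: x (fun s => (r%:C)^-1 * q s)); apply/funext => s.
have := congr1 (@^~ s) (xp _ hp); rewrite /coef /= => h.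
rewrite (linearZE _ _ (rep_linear om s)) (sipZl (hdot_sip W)) (sipZr (hdot_sip W)) h.
rewrite conjc_real mulrA -rmorphM /= -expr2 sqr_sqrtr ?ltW // mulVKf //.
by rewrite -q1E.
Qed.

Section GelfandNaimarkSegal.
Context {W : hilbertType R} (om : unitary_rep H W).

Let D := hdot_sip W.

Definition comb (I : Type) (xi : I -> W) (f : seq (R[i] * (H * I))) : W :=
  \sum_(a <- f) a.1 *: om a.2.1 (xi a.2.2).

Lemma hdot_suml I (r : seq I) (F : I -> W) y :
  hdot (\sum_(i <- r) F i) y = \sum_(i <- r) hdot (F i) y.
Proof.
elim: r => [|i r IH]; first by rewrite !big_nil (sip0l D).
by rewrite !big_cons (sipDl D) IH.
Qed.

Lemma hdot_sumr I (r : seq I) (F : I -> W) y :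
  hdot y (\sum_(i <- r) F i) = \sum_(i <- r) hdot y (F i).
Proof.
elim: r => [|i r IH]; first by rewrite !big_nil (sip0r D).
by rewrite !big_cons (sipDr D) IH.
Qed.

Lemma pd_form_coef (I : Type) (xi : I -> W) f g :
  pd_form (fun i j => coef om (xi i) (xi j)) f g = hdot (comb xi f) (comb xi g).
Proof.
rewrite /comb hdot_suml; apply: eq_bigr => a _.
rewrite hdot_sumr; apply: eq_bigr => b _.
rewrite (sipZl D) (sipZr D) mulrA /coef; congr (_ * _).
by rewrite rep_mulE rep_adjoint invgK.
Qed.

Lemma comb_cat (I : Type) (xi : I -> W) f g : comb xi (f ++ g) = comb xi f + comb xi g.
Proof. by rewrite /comb big_cat. Qed.

Lemma comb_scale (I : Type) (xi : I -> W) c f :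
  comb xi [seq (c * a.1, a.2) | a <- f] = c *: comb xi f.
Proof.
by rewrite /comb big_map scaler_sumr; apply: eq_bigr => a _; rewrite scalerA.
Qed.

Lemma rep_comb (I : Type) (xi : I -> W) s f :
  om s (comb xi f) = comb xi [seq (a.1, ((s * a.2.1)%g, a.2.2)) | a <- f].
Proof.
rewrite /comb linear_sumE; last exact: rep_linear.
rewrite big_map; apply: eq_bigr => a _.
by rewrite (linearZE _ _ (rep_linear om s)) rep_mulE.
Qed.

(** Membership in the closed span of the orbit of [w]. *)
Definition cyclic_closure (w v : W) : Prop := forall e : R, 0 < e ->
  exists g, rnorm (v - comb (fun _ : unit => w) g) ^+ 2 < e.

Lemma cyclic_closureP w c u v :
  cyclic_closure w u -> cyclic_closure w v -> cyclic_closure w (c *: u + v).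
Proof.
move=> hu hv e e0; pose k := normc c ^+ 2 + 1.
have k0 : 0 < k by have := sqr_ge0 (normc c); rewrite /k; lra.
have [|g hg] := hu (e / (4 * k)); first by rewrite divr_gt0 //; lra.
have [|g' hg'] := hv (e / 4); first by lra.
exists ([seq (c * a.1, a.2) | a <- g] ++ g').
rewrite comb_cat comb_scale opprD addrACA -scalerBr -!hdot_sip_sq.
set x := u - _; set y := v - _; rewrite -/x -/y -!hdot_sip_sq in hg hg' *.
clearbody x y.
have -> : sip_sq hdot (c *: x + y) = 2 * sip_sq hdot (c *: x) + 2 * sip_sq hdot y
    - sip_sq hdot (c *: x - y).
  by rewrite !(sip_sqD D) (sip_sqN D) (sipNr D) ReN; ring.
have := sip_sq_ge0 D (c *: x - y); rewrite (sip_sqZ D).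
have h : normc c ^+ 2 * sip_sq hdot x <= e / 4.
  apply: (@le_trans _ _ (k * (e / (4 * k)))).
    by rewrite ler_pM ?sqr_ge0 ?(sip_sq_ge0 D) ?ltW // /k ltrDl.
  by rewrite le_eqVlt; apply/orP; left; apply/eqP; field; rewrite gt_eqF.
by lra.
Qed.

Lemma cyclic_closure_rep w s v : cyclic_closure w v -> cyclic_closure w (om s v).
Proof.
move=> hv e /hv[g hg]; exists [seq (a.1, ((s * a.2.1)%g, a.2.2)) | a <- g].
have -> : om s v - comb (fun _ : unit => w) [seq (a.1, ((s * a.2.1)%g, a.2.2)) | a <- g]
    = om s (v - comb (fun _ : unit => w) g).
  have omL := rep_linear om s.
  by rewrite -rep_comb (linearDE _ _ omL) -(scaleN1r (comb _ _)) (linearZE _ _ omL) scaleN1r.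
by rewrite rep_rnorm.
Qed.

Lemma cyclic_closure0 w : cyclic_closure w 0.
Proof.
move=> e e0; exists [::]; rewrite /comb big_nil subr0 rnorm0 expr0n //.
Qed.

Lemma cyclic_closure_comb (I : Type) w (xi : I -> W) f :
  (forall i, cyclic_closure w (xi i)) -> cyclic_closure w (comb xi f).
Proof.
move=> h; elim: f => [|a f IH]; first by rewrite /comb big_nil; apply: cyclic_closure0.
by rewrite /comb big_cons; apply: cyclic_closureP => //; apply: cyclic_closure_rep.
Qed.

Lemma cyclic_closure_self w : cyclic_closure w w.
Proof.
move=> e e0; exists [:: (1, (1%g, tt))].
by rewrite /comb big_seq1 /= scale1r rep1E subrr rnorm0 expr0n.
Qed.

Lemma cyclic_closure_eq0 w v : cyclic_closure w v ->
  (forall s, hdot (om s w) v = 0) -> v = 0.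
Proof.
move=> hv v0; apply: hdot_definite.
have h0 : hdot v v = 0; last by rewrite /sip_sq h0.
apply: normc_eq0P => e e0.
have N0 := sip_sq_ge0 D v; set N := sip_sq hdot v in N0.
have e'0 : 0 < e / (N + 1) by rewrite divr_gt0 //; lra.
have [g hg] := hv _ e'0; set m := comb _ g in hg.
have -> : hdot v v = hdot (v - m) v.
  rewrite (sipBl D) /m /comb hdot_suml big1 ?subr0 // => a _.
  by rewrite (sipZl D) v0 mulr0.
apply: le_trans (sip_CauchySchwarz D _ _) _; rewrite -/N hdot_sip_sq.
apply: (@le_trans _ _ (e / (N + 1) * N)); first by rewrite ler_wpM2r // ltW.
by rewrite mulrAC ler_pdivrMr ?ler_pM2l //; lra.
Qed.

Hypothesis hom : universal_rep om.

Definition at_index (I : Type) (i : I) (g : seq (R[i] * (H * unit))) :=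
  [seq (a.1, (a.2.1, i)) | a <- g].

Lemma big_at_index (I : Type) (i : I) g (F : R[i] * (H * I) -> R[i]) :
  \sum_(a <- at_index i g) F a = \sum_(a <- g) F (a.1, (a.2.1, i)).
Proof. by rewrite big_map. Qed.

(** Positivity of [p] on [x_i0]-combinations together with [x_i] bounds the
    functional [om s w |-> p i0 i s] on the cyclic subspace of [w], so that the
    Riesz lemma applies to it. *)
Lemma cyclic_representation (I : Type) (p : I -> I -> H -> R[i]) i0 w i :
  matrix_positive_definite p -> coef om w w = p i0 i0 ->
  exists2 xi, cyclic_closure w xi & forall s, hdot (om s w) xi = p i0 i s.
Proof.
move=> pd wE.
pose lift (g : seq (R[i] * (H * unit))) := at_index i0 g.
pose ev (g : seq (R[i] * (H * unit))) := \sum_(a <- g) a.1 * p i0 i a.2.1.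
pose cw := comb (fun _ : unit => w).
pose L m l := exists g, m = cw g /\ l = ev g.
have ii0 : 0 <= p i i 1%g.
  have := pd [:: (1, (1%g, i))].
  by rewrite /pd_form !big_seq1; cbn [fst snd]; rewrite conjc1 !mul1r invg1 mulg1.
have ev_cat f g : ev (f ++ g) = ev f + ev g by rewrite /ev big_cat.
have ev_scale c f : ev [seq (c * a.1, a.2) | a <- f] = c * ev f.
  by rewrite /ev big_map mulr_sumr; apply: eq_bigr => a _; rewrite mulrA.
have lift_form g : pd_form p (lift g) (lift g) = hdot (cw g) (cw g).
  rewrite -pd_form_coef /pd_form big_at_index; apply: eq_bigr => a _.
  by rewrite big_at_index; apply: eq_bigr => b _; rewrite wE.
have lift_ev t g : pd_form p (lift g) [:: (t, (1%g, i))] = conjc t * ev g.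
  rewrite /pd_form big_at_index mulr_sumr; apply: eq_bigr => a _.
  by rewrite big_seq1; cbn [fst snd]; rewrite invg1 mul1g mulrAC mulrC mulrA.
have ev_lift t g : pd_form p [:: (t, (1%g, i))] (lift g) = t * conjc (ev g).
  rewrite /pd_form big_seq1 big_at_index conjc_sum mulr_sumr; apply: eq_bigr => a _.
  by cbn [fst snd]; rewrite mulg1 conjcM -mulrA (matrix_pd_sym i i0 _ pd) invgK.
have [|||| xi [xiP xiC]] := @sip_riesz _ _ _ (hdot_sip W) L (complex.Re (p i i 1%g))
    (@hdot_complete R W).
- by exists [::]; rewrite /cw /comb /ev !big_nil.
- move=> c m l m' l' [g [-> ->]] [g' [-> ->]].
  exists ([seq (c * a.1, a.2) | a <- g] ++ g').
  by rewrite ev_cat ev_scale /cw comb_cat comb_scale.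
- by rewrite -ler0c -ge0_ReE.
- move=> _ _ [g [-> ->]]; rewrite mulrC.
  apply: complex_discriminant; rewrite ?(sip_sq_ge0 (hdot_sip W)) // -?ler0c -?ge0_ReE //.
  move=> t; have := pd (lift g ++ [:: (t, (1%g, i))]).
  rewrite pd_form_catl !pd_form_catr lift_form lift_ev ev_lift.
  rewrite [pd_form p [:: _] [:: _]]big_seq1 big_seq1; cbn [fst snd].
  rewrite invg1 mulg1 normc_sq (ge0_ReE ii0) lecE => /andP[_]; rewrite !ReD.
  rewrite -(ReJ (t * _)) conjcM conjcK ReZ /=.
  by rewrite /sip_sq; lra.
exists xi.
  move=> e /xiC[m [l [[g [mE _]] h]]]; exists g.
  by rewrite -hdot_sip_sq -/(cw g) -mE.
move=> s; apply: xiP; exists [:: (1, (s, tt))].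
by rewrite /cw /comb /ev !big_seq1 /= scale1r mul1r.
Qed.

(** The induction runs over the indices [i] that remain to be treated: once the
    vectors of one cyclic summand are split off, the Schur complement
    [p i j - coef om (xi i) (xi j)] is again positive definite, by approximating
    combinations of the [xi i] inside the cyclic subspace of [w]. *)
Lemma gns_seq (I : eqType) (l : seq I) (p : I -> I -> H -> R[i]) :
  matrix_positive_definite p ->
  (forall i, continuous (p i i : H -> R[i]^o)) ->
  (forall i j s, (i \notin l) || (j \notin l) -> p i j s = 0) ->
  exists X : seq (I -> W), forall i j s,
    p i j s = \sum_(xi <- X) coef om (xi i) (xi j) s.
Proof.
elim: l p => [|i0 l IH] p pd pc p0.
  by exists [::] => i j s; rewrite big_nil p0.
have [w wE] := universal_vector hom (pc i0) (matrix_pd_diag i0 pd).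
have /choice[xi xiP] : forall i, exists v, cyclic_closure w v /\
    forall s, hdot (om s w) v = p i0 i s.
  by move=> i; have [v ? ?] := cyclic_representation i pd wE; exists v.
have xiC i : cyclic_closure w (xi i) by case: (xiP i).
have xiE i s : hdot (om s w) (xi i) = p i0 i s by case: (xiP i).
have xi0 : xi i0 = w.
  apply/subr0_eq; apply: (@cyclic_closure_eq0 w).
    rewrite addrC -scaleN1r; apply: cyclic_closureP => //.
    exact: cyclic_closure_self.
  by move=> s; rewrite (sipBr D) xiE -wE subrr.
have xiE' i s : coef om (xi i) w s = p i i0 s.
  rewrite (matrix_pd_sym i i0 s pd) -xiE -(sipC D) /coef.
  by rewrite rep_adjoint.
pose p' i j s := p i j s - coef om (xi i) (xi j) s.
have pd' : matrix_positive_definite p'.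
  move=> f; rewrite pd_form_B pd_form_coef; set v := comb xi f.
  (* Add to [f] a combination [g] of translates of [x_i0] with vector close to [- v]. *)
  rewrite (ge0_ReE (pd f)) hdot_sq -rmorphB /= ler0c subr_ge0.
  apply/ler_addgt0Pl => e e0.
  have [|g hg] := @cyclic_closureP w (-1) v 0 _ (cyclic_closure0 w) e e0.
    exact: cyclic_closure_comb.
  move: hg; set cw := comb _ g; rewrite addr0 scaleN1r => hg.
  have vg : pd_form p f (at_index i0 g) = hdot v cw.
    rewrite hdot_suml; apply: eq_bigr => a _.
    rewrite big_at_index hdot_sumr; apply: eq_bigr => b _; cbn [fst snd].
    rewrite (sipZl D) (sipZr D) mulrA -xiE' /coef; congr (_ * _).
    by rewrite rep_mulE rep_adjoint invgK.
  have gv : pd_form p (at_index i0 g) f = hdot cw v.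
    rewrite hdot_suml /pd_form big_at_index; apply: eq_bigr => a _.
    rewrite hdot_sumr; apply: eq_bigr => b _; cbn [fst snd].
    rewrite (sipZl D) (sipZr D) mulrA -xiE /coef; congr (_ * _).
    by rewrite rep_mulE rep_adjoint invgK.
  have gg : pd_form p (at_index i0 g) (at_index i0 g) = hdot cw cw.
    rewrite -pd_form_coef /pd_form big_at_index; apply: eq_bigr => a _.
    by rewrite big_at_index; apply: eq_bigr => b _; rewrite wE.
  have := pd (f ++ at_index i0 g).
  rewrite pd_form_catl !pd_form_catr vg gv gg lecE => /andP[_]; rewrite !ReD.
  rewrite -!hdot_sip_sq (sip_sqBC D) opprK addrC (sip_sqD D) in hg *.
  by move: hg; rewrite /sip_sq (sipC D v cw) ReJ; lra.
have [i|i j s h|X XP] := IH p' pd'.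
- move=> s; apply/cvg_normcP => e e0; have e20 : 0 < e / 4 by lra.
  have /cvg_normcP/(_ _ e20) := pc i s.
  have /cvg_normcP/(_ _ e20) := @coef_continuous _ _ _ om (xi i) (xi i) s.
  apply: filterS2 => t h1 h2; rewrite /p' opprB addrACA.
  apply: le_lt_trans (_ : normc (p i i s - p i i t) + normc (coef om (xi i) (xi i) s
    - coef om (xi i) (xi i) t) < _); last by lra.
  rewrite -[X in _ <= _ + X]normcN opprB.
  apply: le_trans (le_normcD _ _); rewrite le_eqVlt; apply/orP; left; apply/eqP.
  by congr normc; ring.
- have h0 (k : I) : k \notin l -> forall j' s', p' k j' s' = 0 /\ p' j' k s' = 0.
    move=> kl j' s'; rewrite /p'; have [->|ki] := eqVneq k i0.
      by rewrite xi0 xiE' /coef xiE !subrr.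
    have pk i' t : p k i' t = 0 /\ p i' k t = 0.
      by rewrite !p0 // !inE !negb_or ki kl ?orbT.
    have -> : xi k = 0.
      by apply: (@cyclic_closure_eq0 w) => // t; rewrite xiE; case: (pk i0 t).
    rewrite /coef (linear0E (rep_linear om s')) (sip0l D) (sip0r D) !subr0.
    exact: pk.
  by case/orP: h => /h0 /(_ _ s) h; [case: (h j)|case: (h i)].
exists (xi :: X) => i j s; rewrite big_cons -XP /p'.
by rewrite addrC subrK.
Qed.

(** The sum over [X] says that the vectors live in a finite multiple of [om]. A
    single positive definite function has a vector in the universal
    representation by definition; the point is that one family of vectors
    serves all the entries of the matrix, with [sum |xi i|^2 = p i i 1]. This is what complete contractivity rests on. *)
Lemma gns (I : finType) (p : I -> I -> H -> R[i]) :
  matrix_positive_definite p ->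
  (forall i, continuous (p i i : H -> R[i]^o)) ->
  exists X : seq (I -> W), forall i j s,
    p i j s = \sum_(xi <- X) coef om (xi i) (xi j) s.
Proof.
move=> pd pc; apply: (@gns_seq I (enum I)) => // i j s.
by rewrite !mem_enum.
Qed.

End GelfandNaimarkSegal.
End PositiveDefinite.

(** * The norm of the Fourier-Stieltjes algebra and the pairing *)

Lemma sum_CauchySchwarz (R : realType) (I : Type) (r : seq I) (a b : I -> R) :
  (\sum_(i <- r) a i * b i) ^+ 2 <=
  (\sum_(i <- r) a i ^+ 2) * (\sum_(i <- r) b i ^+ 2).
Proof.
set A := \sum_(i <- r) a i ^+ 2; set B := \sum_(i <- r) b i ^+ 2.
set S := \sum_(i <- r) a i * b i.
have A0 : 0 <= A by apply: sumr_ge0 => i _; apply: sqr_ge0.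
have B0 : 0 <= B by apply: sumr_ge0 => i _; apply: sqr_ge0.
suff : normc (S%:C) ^+ 2 <= A * B by rewrite normc_real real_normK ?num_real.
apply: complex_discriminant => // t.
rewrite [conjc t * _]mulrC ReZ ReJ sqr_normcE; case: t => x y /=.
have : 0 <= \sum_(i <- r) (a i + x * b i) ^+ 2.
  by apply: sumr_ge0 => i _; apply: sqr_ge0.
have -> : \sum_(i <- r) (a i + x * b i) ^+ 2 = A + 2 * x * S + x ^+ 2 * B.
  rewrite /A /B /S !mulr_sumr -!big_split; apply: eq_bigr => i _ /=; ring.
by have : 0 <= y ^+ 2 * B; [rewrite mulr_ge0 ?sqr_ge0 | lra].
Qed.

Section FourierStieltjesNorm.
Context {R : realType} {G : topologicalGroupType}.
Implicit Types u v : G -> R[i].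

Lemma fs_coef (V : hilbertType R) (pi : unitary_rep G V) x y :
  fourier_stieltjes (coef pi x y).
Proof. by exists V, pi, x, y. Qed.

Lemma fs_norm_lb u : lbound [set r | exists (V : hilbertType R)
  (pi : unitary_rep G V) (x y : V), u = coef pi x y /\ r = rnorm x * rnorm y] 0.
Proof. by move=> r [V [pi [x [y [_ ->]]]]]; rewrite mulr_ge0 ?rnorm_ge0. Qed.

Lemma fs_norm_le (V : hilbertType R) (pi : unitary_rep G V) x y :
  fs_norm (coef pi x y) <= rnorm x * rnorm y.
Proof. by apply: ge_inf; [exists 0; exact: fs_norm_lb|exists V, pi, x, y]. Qed.

(** Used to bound functionals: it suffices to estimate them through an arbitrary
    realization of [u] as a coefficient. *)
Lemma fs_norm_ge u (a C : R) : fourier_stieltjes u -> 0 <= C ->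
  (forall (V : hilbertType R) (pi : unitary_rep G V) (x y : V), u = coef pi x y ->
     a <= C * (rnorm x * rnorm y)) ->
  a <= C * fs_norm u.
Proof.
move=> [V [pi [x [y uE]]]] C0 h.
have [C0'|C0'] := ltrP 0 C; last first.
  have C1 : C = 0 by apply/eqP; rewrite eq_le C0 C0'.
  by have := h _ _ _ _ uE; rewrite C1 !mul0r.
rewrite -ler_pdivrMl //; apply: lb_le_inf; first by exists (rnorm x * rnorm y), V, pi, x, y.
by move=> _ [V' [pi' [x' [y' [u'E ->]]]]]; rewrite ler_pdivrMl //; apply: h u'E.
Qed.

Lemma fs_norm_ge0 u : fourier_stieltjes u -> 0 <= fs_norm u.
Proof.
move=> hu; rewrite -[fs_norm u]mul1r; apply: fs_norm_ge => // V pi x y _.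
by rewrite mul1r mulr_ge0 ?rnorm_ge0.
Qed.

Section CoefSpace.
Context {V : hilbertType R} (pi : unitary_rep G V).

Lemma coef_span_closure u : fourier_stieltjes u -> coef_span pi u -> coef_space pi u.
Proof.
move=> fu su; split=> // e e0; exists u => //.
have -> : u \- u = coef pi 0 0.
  by apply/funext => s /=; rewrite subrr /coef (sip0r (hdot_sip V)).
by apply: le_lt_trans (fs_norm_le _ _ _) _; rewrite rnorm0 mul0r.
Qed.

Lemma coef_space_coef x y : coef_space pi (coef pi x y).
Proof.
apply: coef_span_closure; first exact: fs_coef.
exists 1, (fun=> 1), (fun=> x), (fun=> y); apply/funext => s.
by rewrite big_ord1 mul1r.
Qed.

Hypothesis AP : forall c u v, coef_space pi u -> coef_space pi v ->
  coef_space pi (fun s => c * u s + v s).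

Lemma coef_space0 : coef_space pi (fun=> 0).
Proof.
have -> : (fun=> 0) = coef pi 0 0; last exact: coef_space_coef.
by apply/funext => s; rewrite /coef (sip0r (hdot_sip V)).
Qed.

Lemma bounded_functional0 phi : bounded_functional (coef_space pi) phi ->
  phi (fun=> 0) = 0.
Proof.
move=> [philin _]; have := philin (-1) _ _ coef_space0 coef_space0.
have -> : (fun s : G => -1 * (0 : R[i]) + 0) = fun=> 0.
  by apply/funext => s; rewrite mulr0 addr0.
by rewrite mulN1r addNr.
Qed.

Lemma functional_span_eq phi psi :
  bounded_functional (coef_space pi) phi -> bounded_functional (coef_space pi) psi ->
  (forall x y, phi (coef pi x y) = psi (coef pi x y)) ->
  forall v, coef_span pi v -> coef_space pi v /\ phi v = psi v.
Proof.
move=> bphi bpsi e v [n [c [x [y ->]]]].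
have -> : (fun s => \sum_i c i * coef pi (x i) (y i) s) =
    (fun s => \sum_(i <- enum 'I_n) c i * coef pi (x i) (y i) s).
  by apply/funext => s; rewrite big_enum.
elim: (enum 'I_n) => [|i r [IHA IH]].
  have -> : (fun s : G => \sum_(i <- [::]) c i * coef pi (x i) (y i) s) = fun=> 0.
    by apply/funext => s; rewrite big_nil.
  by split; [exact: coef_space0|rewrite !bounded_functional0].
have -> : (fun s : G => \sum_(j <- i :: r) c j * coef pi (x j) (y j) s) =
    fun s => c i * coef pi (x i) (y i) s + \sum_(j <- r) c j * coef pi (x j) (y j) s.
  by apply/funext => s; rewrite big_cons.
have Ai := coef_space_coef (x i) (y i).
split; first exact: AP.
by rewrite (bphi.1 _ _ _ Ai IHA) (bpsi.1 _ _ _ Ai IHA) IH e.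
Qed.

(** Coefficients span a dense subspace, so the functional represented by an
    operator is unique and the pairing is computed by any such functional. *)
Lemma functional_eq phi psi u :
  bounded_functional (coef_space pi) phi -> bounded_functional (coef_space pi) psi ->
  (forall x y, phi (coef pi x y) = psi (coef pi x y)) ->
  coef_space pi u -> phi u = psi u.
Proof.
move=> bphi bpsi e Au; have [lphi [C1 hC1]] := bphi; have [lpsi [C2 hC2]] := bpsi.
apply/subr0_eq/normc_eq0P => eps eps0.
(* The bounds [C1] and [C2] may be negative; their squares are all that enters. *)
pose C := 1 + 2 * (C1 ^+ 2 + C2 ^+ 2).
have C0 : 0 < C by rewrite /C; have := sqr_ge0 C1; have := sqr_ge0 C2; lra.
have e'0 : 0 < Num.sqrt (eps / C) by rewrite sqrtr_gt0 divr_gt0.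
have [v Sv] := Au.2 _ e'0.
have [Av ev] := functional_span_eq bphi bpsi e Sv.
have Auv : coef_space pi (u \- v).
  have -> : u \- v = fun s => -1 * v s + u s by apply/funext => s; rewrite mulN1r addrC.
  exact: AP.
have -> : phi u - psi u = phi (u \- v) + - psi (u \- v).
  have -> : u \- v = fun s => -1 * v s + u s by apply/funext => s; rewrite mulN1r addrC.
  by rewrite lphi // lpsi // ev; ring.
have n0 := fs_norm_ge0 Auv.1; set n := fs_norm _ in n0 *.
move=> /(lt_sqr_sqrt n0 (divr_gt0 eps0 C0)) hn.
apply: le_trans (normc_sqD _ _) _; rewrite normcN.
have h1 := hC1 _ Auv; have h2 := hC2 _ Auv.
rewrite -/n !normc_ReE in h1 h2.
have k1 : normc (phi (u \- v)) ^+ 2 <= C1 ^+ 2 * n ^+ 2.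
  by rewrite -exprMn ler_pXn2r ?nnegrE ?normc_ge0 // (le_trans (normc_ge0 _) h1).
have k2 : normc (psi (u \- v)) ^+ 2 <= C2 ^+ 2 * n ^+ 2.
  by rewrite -exprMn ler_pXn2r ?nnegrE ?normc_ge0 // (le_trans (normc_ge0 _) h2).
apply: (@le_trans _ _ (C * n ^+ 2)).
  by have := sqr_ge0 n; rewrite /C; lra.
by rewrite -ler_pdivlMl // mulrC ltW.
Qed.

Lemma pairingE T phi u : represents pi T phi -> coef_space pi u ->
  pairing pi T u = phi u.
Proof.
move=> hphi Au; rewrite /pairing; apply: xget_unique; first by exists phi.
move=> _ [psi hpsi ->]; apply: functional_eq => //; [exact: hpsi.1|exact: hphi.1|].
by move=> x y; rewrite hphi.2 hpsi.2.
Qed.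

End CoefSpace.
End FourierStieltjesNorm.

(** * The dual of the Fourier-Stieltjes algebra *)

Section Universal.
Context {R : realType} {H : topologicalGroupType}.

Lemma coef_matrix_pd (I : Type) (V : hilbertType R) (tau : unitary_rep H V) (x : I -> V) :
  matrix_positive_definite (fun i j => coef tau (x i) (x j)).
Proof. by move=> f; rewrite pd_form_coef; apply: (sip_ge0 (hdot_sip V)). Qed.

Context {W : hilbertType R} (om : unitary_rep H W).

Let D := hdot_sip W.

Definition pair_coef (X : seq (W * W)) : H -> R[i] :=
  fun s => \sum_(a <- X) coef om a.1 a.2 s.

Lemma coef_normalized z : exists L : seq (R[i] * (H -> R[i])),
  (forall a, a \in L -> normalized_pd a.2) /\
  forall s, coef om z z s = \sum_(a <- L) a.1 * a.2 s.
Proof.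
have [->|z0] := eqVneq z 0.
  by exists [::]; split=> // s; rewrite big_nil /coef (sip0r D).
have n0 : rnorm z != 0 by apply: contra z0 => /eqP/rnorm_eq0/eqP.
set z' := ((rnorm z)^-1)%:C *: z.
have zE : z = (rnorm z)%:C *: z' by rewrite scalerA -rmorphM /= divff // scale1r.
exists [:: ((rnorm z ^+ 2)%:C, coef om z' z')]; split=> [a|s].
  rewrite inE => /eqP -> /=; split.
  - exact: coef_continuous.
  - exact: (matrix_pd_diag tt (@coef_matrix_pd unit W om (fun=> z'))).
  rewrite /coef rep1E hdot_sq rnormZ normc_real ger0_norm ?invr_ge0 ?rnorm_ge0 //.
  by rewrite mulVf // expr1n.
rewrite big_seq1 /= {1 2}zE /coef (linearZE _ _ (rep_linear om s)) (sipZl D) (sipZr D).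
by rewrite conjc_real mulrA expr2 rmorphM.
Qed.

Lemma hdot_polarization (T : W -> W) x y : linear T ->
  hdot (T x) y = 4^-1 * (hdot (T (x + y)) (x + y) - hdot (T (x - y)) (x - y)
    + 'i * hdot (T (x + 'i *: y)) (x + 'i *: y)
    - 'i * hdot (T (x - 'i *: y)) (x - 'i *: y)).
Proof.
move=> linT; have TN v : T (- v) = - T v by rewrite -scaleN1r (linearZE _ _ linT) scaleN1r.
rewrite !(linearDE _ _ linT) !TN !(linearZE _ _ linT).
rewrite !(sipDl D) !(sipDr D) !(sipNl D) !(sipNr D) !(sipZl D) !(sipZr D).
have -> : conjc ('i : R[i]) = - 'i by apply/eqP; rewrite eq_complex /= oppr0 !eqxx.
have i2 : ('i : R[i]) * 'i = -1 by rewrite -expr2 sqr_i.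
set a := hdot (T x) x; set b := hdot (T x) y; set c := hdot (T y) x; set d := hdot (T y) y.
apply: (@mulfI _ 4); first by rewrite pnatr_eq0.
rewrite mulVKf ?pnatr_eq0 //.
have -> : 4 * b = 2 * b + 2 * c - 2 * (- 1) * b + 2 * (- 1) * c by ring.
by rewrite -i2; ring.
Qed.

Lemma pair_coef_normalized X : exists L : seq (R[i] * (H -> R[i])),
  (forall a, a \in L -> normalized_pd a.2) /\
  forall s, pair_coef X s = \sum_(a <- L) a.1 * a.2 s.
Proof.
elim: X => [|[x y] X [L [nL LE]]].
  by exists [::]; split=> // s; rewrite /pair_coef !big_nil.
have scale c (L' : seq (R[i] * (H -> R[i]))) :
    (forall a, a \in L' -> normalized_pd a.2) ->
    forall a, a \in [seq (c * b.1, b.2) | b <- L'] -> normalized_pd a.2.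
  by move=> h a /mapP[b bL ->]; apply: h bL.
have [L1 [n1 E1]] := coef_normalized (x + y).
have [L2 [n2 E2]] := coef_normalized (x - y).
have [L3 [n3 E3]] := coef_normalized (x + 'i *: y).
have [L4 [n4 E4]] := coef_normalized (x - 'i *: y).
exists ([seq (4^-1 * b.1, b.2) | b <- L1] ++ [seq (- 4^-1 * b.1, b.2) | b <- L2] ++
        [seq (4^-1 * 'i * b.1, b.2) | b <- L3] ++
        [seq (- (4^-1 * 'i) * b.1, b.2) | b <- L4] ++ L); split.
  move=> a; rewrite !mem_cat => /or4P[| | |/orP[]]; by [exact: scale|exact: nL].
move=> s; rewrite /pair_coef big_cons -/(pair_coef X s) LE /=.
rewrite /coef (@hdot_polarization (om s)); last exact: rep_linear.
rewrite -!/(coef om _ _ s) E1 E2 E3 E4 !big_cat !big_map /=.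
rewrite !addrA; congr (_ + _); rewrite !mulrDr !mulrN !mulrA.
by rewrite -!mulNr !mulr_sumr; congr (_ + _ + _ + _); apply: eq_bigr => a _; rewrite !mulrA ?mulNr.
Qed.

Hypothesis hom : universal_rep om.

(** The cyclic vectors of distinct normalized functions are orthogonal, so a
    linear combination of normalized functions is a single coefficient. *)
Lemma pair_coef_fs X : fourier_stieltjes (pair_coef X).
Proof.
have [L [nL LE]] := pair_coef_normalized X.
have [x [xp xorth _]] := hom.
pose P := undup [seq a.2 | a <- L].
have nP p : p \in P -> normalized_pd p.
  by rewrite mem_undup => /mapP[a aL ->]; apply: nL.
exists W, om, (\sum_(a <- L) a.1 *: x a.2), (\sum_(p <- P) x p).
apply/funext => s; rewrite LE /coef (linear_sumE _ _ (rep_linear om s)) hdot_suml.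
rewrite big_seq [RHS]big_seq; apply: eq_bigr => a aL.
have aP : a.2 \in P by rewrite mem_undup; apply: map_f.
rewrite (linearZE _ _ (rep_linear om s)) (sipZl D) hdot_sumr; congr (_ * _).
rewrite (bigD1_seq a.2) ?undup_uniq //= -[X in X s](xp _ (nP _ aP)).
rewrite big_seq_cond big1 ?addr0 // => p /andP[pP pa].
apply: xorth; [exact: nP|exact: nP|].
by move=> ap; rewrite ap eqxx in pa.
Qed.

Lemma pair_coef_space X : coef_space om (pair_coef X).
Proof.
apply: coef_span_closure; first exact: pair_coef_fs.
exists (size X), (fun=> 1), (fun i => (tnth (in_tuple X) i).1), (fun i => (tnth (in_tuple X) i).2).
apply/funext => s; rewrite /pair_coef big_tnth.
by apply: eq_bigr => i _; rewrite mul1r.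
Qed.

(** The positive definite matrix of the pair [x, y], realized in a multiple of
    the universal representation. *)
Lemma fs_pair_coef (V : hilbertType R) (tau : unitary_rep H V) x y :
  exists X : seq (W * W), [/\ coef tau x y = pair_coef X,
    \sum_(a <- X) rnorm a.1 ^+ 2 = rnorm x ^+ 2 &
    \sum_(a <- X) rnorm a.2 ^+ 2 = rnorm y ^+ 2].
Proof.
pose v (b : bool) := if b then x else y.
have [|X XE] := gns hom (@coef_matrix_pd bool V tau v).
  by move=> b; apply: coef_continuous.
have normE b : \sum_(xi <- X) rnorm (xi b) ^+ 2 = rnorm (v b) ^+ 2.
  have := XE b b 1%g; rewrite /coef rep1E hdot_sq => h; apply: complexI; rewrite h.
  by rewrite rmorph_sum /=; apply: eq_bigr => xi _; rewrite rep1E hdot_sq.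
exists [seq (xi true, xi false) | xi <- X]; split.
- apply/funext => s; rewrite /pair_coef big_map; exact: (XE true false s).
- by rewrite big_map (normE true).
- by rewrite big_map (normE false).
Qed.

Lemma coef_space_pair_coef u : coef_space om u -> exists X, u = pair_coef X.
Proof. by move=> [[V [tau [x [y ->]]]] _]; have [X [-> _ _]] := fs_pair_coef tau x y; exists X. Qed.

Lemma pair_coefP c X Y : (fun s => c * pair_coef X s + pair_coef Y s) =
  pair_coef ([seq (c *: a.1, a.2) | a <- X] ++ Y).
Proof.
apply/funext => s; rewrite /pair_coef big_cat big_map mulr_sumr /=; congr (_ + _).
by apply: eq_bigr => a _; rewrite /coef (linearZE _ _ (rep_linear om s)) (sipZl D).
Qed.

Lemma coef_space_universalP c u v : coef_space om u -> coef_space om v ->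
  coef_space om (fun s => c * u s + v s).
Proof.
move=> /coef_space_pair_coef[X ->] /coef_space_pair_coef[Y ->]; rewrite pair_coefP.
exact: pair_coef_space.
Qed.

Definition op_sum (T : W -> W) (X : seq (W * W)) := \sum_(a <- X) hdot (T a.1) a.2.

Lemma op_sum_eq T X Y : rep_vNA om T -> pair_coef X = pair_coef Y ->
  op_sum T X = op_sum T Y.
Proof.
move=> vT XY; have bT : bounded_op T.
  by move: vT; rewrite rep_vNA_bicommutant; apply: commutant_bounded.
have /bounded_opP[linT _] := bT.
pose Z := X ++ [seq (- a.1, a.2) | a <- Y].
have op_sumZ (S : W -> W) : linear S ->
    op_sum S Z = op_sum S X - op_sum S Y.
  move=> linS; rewrite /op_sum big_cat big_map /= -sumrN; congr (_ + _).
  by apply: eq_bigr => a _; rewrite -scaleN1r (linearZE _ _ linS) scaleN1r (sipNl D).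
apply/subr0_eq; rewrite -op_sumZ // /op_sum big_tnth.
apply: (rep_vNA_functional_eq0 vT (x := fun i => (tnth (in_tuple Z) i).1)
  (y := fun i => (tnth (in_tuple Z) i).2)) => s.
transitivity (op_sum (om s) Z); first by rewrite /op_sum [RHS]big_tnth.
rewrite op_sumZ; last exact: rep_linear.
by have := congr1 (@^~ s) XY; rewrite /pair_coef /coef /op_sum => ->; rewrite subrr.
Qed.

Lemma op_sum_bound T X C a b : 0 <= C -> (forall x, rnorm (T x) <= C * rnorm x) ->
  0 <= a -> 0 <= b ->
  \sum_(p <- X) rnorm p.1 ^+ 2 <= a ^+ 2 -> \sum_(p <- X) rnorm p.2 ^+ 2 <= b ^+ 2 ->
  normc (op_sum T X) <= C * (a * b).
Proof.
move=> C0 hC a0 b0 Xa Xb.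
have h : normc (op_sum T X) <= C * \sum_(p <- X) rnorm p.1 * rnorm p.2.
  rewrite /op_sum; elim: X {Xa Xb} => [|p X IH]; first by rewrite !big_nil mulr0 normc0.
  rewrite !big_cons mulrDr; apply: le_trans (le_normcD _ _) _; apply: lerD => //.
  by apply: le_trans (hdot_CS _ _) _; rewrite mulrA ler_wpM2r ?rnorm_ge0.
apply: le_trans h _; rewrite ler_wpM2l //.
rewrite -(@ler_pXn2r _ 2) ?nnegrE ?mulr_ge0 //; last first.
  by apply: sumr_ge0 => p _; rewrite mulr_ge0 ?rnorm_ge0.
apply: le_trans (sum_CauchySchwarz _ _ _) _; rewrite exprMn.
by apply: ler_pM => //; apply: sumr_ge0 => p _; apply: sqr_ge0.
Qed.

(** The functional [u |-> op_sum T X], for [u = pair_coef X], is well defined by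
    the density theorem and bounded
    because a coefficient of [x] and [y] in any representation is such a sum
    with [sum |a.1|^2 = |x|^2] and [sum |a.2|^2 = |y|^2]. *)
Lemma pairing_pair_coef T X : rep_vNA om T -> pairing om T (pair_coef X) = op_sum T X.
Proof.
move=> vT; have bT : bounded_op T.
  by move: vT; rewrite rep_vNA_bicommutant; apply: commutant_bounded.
have /bounded_opP[linT [C C0 hC]] := bT.
pose phi u := xget 0 [set z | exists2 Y, u = pair_coef Y & z = op_sum T Y].
have phiE Y : phi (pair_coef Y) = op_sum T Y.
  apply: xget_unique; first by exists Y.
  by move=> _ [Z YZ ->]; apply: op_sum_eq.
rewrite -phiE; apply: pairingE; [exact: coef_space_universalP| |exact: pair_coef_space].
split; last first.
  move=> x y; have -> : coef om x y = pair_coef [:: (x, y)].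
    by apply/funext => s; rewrite /pair_coef big_seq1.
  by rewrite phiE /op_sum big_seq1.
split=> [c u v /coef_space_pair_coef[Y ->] /coef_space_pair_coef[Z ->]|].
  rewrite pair_coefP !phiE /op_sum big_cat big_map mulr_sumr /=; congr (_ + _).
  by apply: eq_bigr => a _; rewrite (linearZE _ _ linT) (sipZl D).
exists C => u Au; apply: fs_norm_ge => //; first exact: Au.1.
move=> V tau x y ->; have [Y [-> Yx Yy]] := fs_pair_coef tau x y.
by rewrite phiE normc_ReE; apply: op_sum_bound => //; rewrite ?rnorm_ge0 ?Yx ?Yy.
Qed.

End Universal.

(** * Groups of contractions *)

Section Contractions.
Context {R : realType} {V : hilbertType R}.
Let D := hdot_sip V.

Lemma opnorm1_contraction (T : V -> V) x : linear T -> opnorm T = 1%E ->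
  rnorm (T x) <= rnorm x.
Proof.
move=> linT T1; have [x0|x0] := eqVneq (rnorm x) 0.
  by rewrite (rnorm_eq0 x0) (linear0E linT).
have xp : 0 < rnorm x by rewrite lt_neqAle eq_sym x0 rnorm_ge0.
have : ((rnorm (T (((rnorm x)^-1)%:C *: x))%R)%:E <= opnorm T)%E.
  apply: ereal_sup_ubound; exists (((rnorm x)^-1)%:C *: x) => //=.
  by rewrite rnormZ normc_real gtr0_norm ?invr_gt0 // mulVf.
rewrite T1 lee_fin (linearZE _ _ linT) rnormZ normc_real gtr0_norm ?invr_gt0 //.
by rewrite ler_pdivrMl // mulr1.
Qed.

(** For [x] in the range and [y] in the kernel of [e], the inequalities
    [|x| <= |x + t y|] for all [t] force [<x, y> = 0]. *)
Lemma contractive_idempotent_adjoint (e : V -> V) : linear e ->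
  (forall x, rnorm (e x) <= rnorm x) -> (forall x, e (e x) = e x) ->
  adjoint_of e e.
Proof.
move=> line e1 ee.
have orth x y : hdot (e x) (y - e y) = 0.
  apply: normc_eq0P => eps eps0; apply: le_trans (ltW eps0).
  rewrite -[leRHS](mul0r (rnorm (y - e y) ^+ 2)).
  apply: complex_discriminant; rewrite ?sqr_ge0 // => t.
  have := e1 (e x + t *: (y - e y)).
  have -> : e (e x + t *: (y - e y)) = e x.
    rewrite (linearDE _ _ line) (linearZE _ _ line) (linearDE _ _ line) ee.
    by rewrite -(scaleN1r (e y)) (linearZE _ _ line) ee scaleN1r subrr scaler0 addr0.
  rewrite -(@ler_pXn2r _ 2) ?nnegrE ?rnorm_ge0 // -!hdot_sip_sq.
  by rewrite (sip_sqD D) (sip_sqZ D) (sipZr D); lra.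
move=> x y; have := orth x y; rewrite (sipBr D) => /subr0_eq ->.
have := orth y x; rewrite (sipBr D) => /subr0_eq h.
by rewrite (sipC D) -h -(sipC D).
Qed.

Section Group.
Context (Dl F : set (V -> V)) (e : V -> V) (inv : (V -> V) -> (V -> V)).
Hypothesis sg : semigroup_subgroup Dl F e inv.
Hypothesis Flin : forall T, F T -> linear T.
Hypothesis Fcontr : forall T x, F T -> rnorm (T x) <= rnorm x.

(** The identity [e] is an orthogonal projection. As [T] and [inv T] are both
    contractive, [T] is isometric on the range of [e], and polarization turns
    [|T x| = |e x|] into [<T x, T y> = <e x, e y>]. *)
Lemma contraction_group_adjoint T : F T -> adjoint_of T (inv T).
Proof.
move=> FT; have Fe := sgrp_id sg; have Fi := sgrp_inv sg FT.
have [eT Te] := sgrp_mul1 sg FT; have [iT Ti] := sgrp_mulV sg FT.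
have [ei _] := sgrp_mul1 sg Fi; have [ee _] := sgrp_mul1 sg Fe.
have eP x : e (e x) = e x by exact: (congr1 (@^~ x) ee).
have esa := contractive_idempotent_adjoint (Flin Fe) (fun x => Fcontr x Fe) eP.
have line := Flin Fe; have linT := Flin FT; have lini := Flin Fi.
have Tnorm x : rnorm (T x) = rnorm (e x).
  have TeE : T (e x) = T x by exact: (congr1 (@^~ x) Te).
  have iTE : inv T (T x) = e x by exact: (congr1 (@^~ x) iT).
  apply/eqP; rewrite eq_le -{1}TeE Fcontr //= -iTE; exact: Fcontr.
have Tdot x y : hdot (T x) (T y) = hdot (e x) (e y).
  apply/subr0_eq/normc_eq0P => eps eps0; apply: le_trans (ltW eps0).
  have h c : complex.Re (conjc c * (hdot (T x) (T y) - hdot (e x) (e y))) = 0.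
    have := Tnorm (x + c *: y).
    rewrite (linearDE _ _ linT) (linearDE _ _ line) (linearZE _ _ linT) (linearZE _ _ line).
    move/(congr1 (fun r => r ^+ 2)); rewrite -!hdot_sip_sq !(sip_sqD D) !(sip_sqZ D).
    by rewrite !(sipZr D) !hdot_sip_sq !Tnorm mulrBr ReB; lra.
  by rewrite -[leRHS](mulr0 0); apply: complex_discriminant => // t; rewrite h; lra.
have iE y : e (inv T y) = inv T y by exact: (congr1 (@^~ y) ei).
move=> x y; rewrite -(congr1 (@^~ x) eT) /= esa -(congr1 (@^~ y) Ti) /=.
by rewrite Tdot esa eP iE.
Qed.

End Group.
End Contractions.

(** * Transport of the spectrum to other representations *)

Section Involution.
Context {R : realType} {G : topologicalGroupType}.

Definition fs_star (u : G -> R[i]) : G -> R[i] := fun s => conjc (u s^-1%g).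

Lemma fs_star_coef (V : hilbertType R) (sg : unitary_rep G V) x y :
  fs_star (coef sg x y) = coef sg y x.
Proof.
apply/funext => s; rewrite /fs_star /coef -(sipC (hdot_sip V)).
by rewrite [RHS]rep_adjoint.
Qed.

End Involution.

Section Extension.
Context {R : realType} {G : topologicalGroupType} {V : hilbertType R}.
Variable pi : unitary_rep G V.
Hypothesis hA : closed_translation_invariant_subalgebra (coef_space pi).

Lemma spectrum_vNA T : spectrum pi T -> rep_vNA pi T.
Proof. by case. Qed.

Lemma rep_vNA_bounded T : rep_vNA pi T -> bounded_op T.
Proof. by rewrite rep_vNA_bicommutant; apply: commutant_bounded. Qed.

(** The pairing takes its default value 0 when no functional is represented by
    the operator; a character is nonzero somewhere, so it is represented. *)
Lemma spectrum_represents T : spectrum pi T -> represents pi T (pairing pi T).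
Proof.
move=> [_ [u Au uT] _].
have [phi hphi] : exists phi, represents pi T phi.
  apply: contrapT => h; move: uT; rewrite /pairing xgetPN ?eqxx //.
  by move=> z [phi hphi _]; apply: h; exists phi.
have phiE v : coef_space pi v -> pairing pi T v = phi v.
  by apply: pairingE => //; exact: ctisaP hA.
split; last by move=> x y; rewrite phiE; [exact: hphi.2|exact: coef_space_coef].
split=> [c v w Av Aw|].
  rewrite !phiE //; first exact: hphi.1.1.
  exact: ctisaP hA _ _ _ Av Aw.
by have [C hC] := hphi.1.2; exists C => v Av; rewrite phiE //; apply: hC.
Qed.

Lemma bounded_functional_nneg phi : bounded_functional (coef_space pi) phi ->
  exists2 C, 0 <= C & forall u, coef_space pi u -> normc (phi u) <= C * fs_norm u.
Proof.
move=> [_ [C hC]]; exists `|C| => // u Au; apply: le_trans (hC u Au) _.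
by rewrite ler_wpM2r ?ler_norm // fs_norm_ge0 //; exact: Au.1.
Qed.

Section Closedness.
Context {V' : hilbertType R} (sg : unitary_rep G V').
Let D' := hdot_sip V'.

Lemma coef_subl x x' y :
  coef sg x y \- coef sg x' y = coef sg (x - x') y.
Proof.
apply/funext => s /=; have linS := rep_linear sg s.
by rewrite /coef (linearDE _ _ linS) -(scaleN1r x') (linearZE _ _ linS) scaleN1r (sipBl D').
Qed.

Lemma coef_closed_left y : closed_subspace (@hdot R V') (fun x => coef_space pi (coef sg x y)).
Proof.
split.
- have -> : coef sg 0 y = fun=> 0; last exact: ctisa0 hA.
  by apply/funext => s; rewrite /coef (linear0E (rep_linear sg s)) (sip0l D').
- move=> c x x' Ax Ax'; have -> : coef sg (c *: x + x') y =
      fun s => c * coef sg x y s + coef sg x' y s; last exact: ctisaP hA _ _ _ Ax Ax'.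
  by apply/funext => s; rewrite /coef rep_linear (sipP D').
move=> x hx; apply: (ctisa_closed hA); split; first exact: fs_coef.
move=> e e0; have y0 := rnorm_ge0 y.
have e1 : 0 < e / (rnorm y + 1) by rewrite divr_gt0 //; lra.
have [|m Am] := hx ((e / (rnorm y + 1)) ^+ 2); first by rewrite exprn_gt0.
rewrite hdot_sip_sq ltr_pXn2r ?nnegrE ?rnorm_ge0 ?ltW // => xm.
exists (coef sg m y) => //; rewrite coef_subl.
apply: le_lt_trans (fs_norm_le _ _ _) _.
apply: (@le_lt_trans _ _ (e / (rnorm y + 1) * rnorm y)).
  by rewrite ler_wpM2r // ltW.
by rewrite mulrAC ltr_pdivrMr ?ltr_pM2l //; lra.
Qed.

Lemma coef_closed_right x : closed_subspace (@hdot R V') (fun y => coef_space pi (coef sg x y)).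
Proof.
split.
- have -> : coef sg x 0 = fun=> 0; last exact: ctisa0 hA.
  by apply/funext => s; rewrite /coef (sip0r D').
- move=> c y y' Ay Ay'; have -> : coef sg x (c *: y + y') =
      fun s => conjc c * coef sg x y s + coef sg x y' s; last exact: ctisaP hA _ _ _ Ay Ay'.
  by apply/funext => s; rewrite /coef (sipDr D') (sipZr D').
move=> y hy; apply: (ctisa_closed hA); split; first exact: fs_coef.
move=> e e0; have x0 := rnorm_ge0 x.
have e1 : 0 < e / (rnorm x + 1) by rewrite divr_gt0 //; lra.
have [|m Am] := hy ((e / (rnorm x + 1)) ^+ 2); first by rewrite exprn_gt0.
rewrite hdot_sip_sq ltr_pXn2r ?nnegrE ?rnorm_ge0 ?ltW // => ym.
exists (coef sg x m) => //.
have -> : coef sg x y \- coef sg x m = coef sg x (y - m).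
  by apply/funext => s /=; rewrite /coef (sipBr D').
apply: le_lt_trans (fs_norm_le _ _ _) _; rewrite mulrC.
apply: (@le_lt_trans _ _ (e / (rnorm x + 1) * rnorm x)).
  by rewrite ler_wpM2r // ltW.
by rewrite mulrAC ltr_pdivrMr ?ltr_pM2l //; lra.
Qed.

Lemma coef_space_right_translate x y s : coef_space pi (coef sg x y) ->
  coef_space pi (coef sg (sg s x) y).
Proof.
move=> /(ctisa_translation hA s)[_]; congr coef_space.
by apply/funext => t; rewrite /coef rep_mulE.
Qed.

Lemma coef_space_left_translate x y s : coef_space pi (coef sg x y) ->
  coef_space pi (coef sg x (sg s y)).
Proof.
move=> /(ctisa_translation hA s^-1%g)[h _]; move: h; congr coef_space.
by apply/funext => t; rewrite /coef rep_mulE rep_adjoint invgK.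
Qed.

(** [P] cuts the representation down to a closed invariant subspace over which
    all the coefficients belong to [A]. *)
Record coef_projection (P : V' -> V') : Prop := {
  cp_linear : linear P;
  cp_le : forall x, rnorm (P x) <= rnorm x;
  cp_id : forall x, P (P x) = P x;
  cp_adjoint : adjoint_of P P;
  cp_rep : forall s x, P (sg s (P x)) = sg s (P x);
  cp_coef : forall x y, coef_space pi (coef sg (P x) (P y))
}.

(** Let [X1] consist of the [v] with [coef sg v y] in [A], and [Y1] of the [w]
    such that [coef sg v w] is in [A] for all [v] in [X1]. Both are closed and
    invariant, because [A] is closed and translation invariant, and [P] is the
    projection onto their intersection. Replacing [y] by its projection on [X1]
    does not change the coefficient, as the orbit of [x] lies in [X1], and
    brings [y] into the intersection; then [x] may be projected as well. *)
Lemma coef_projection_exists x y : coef_space pi (coef sg x y) ->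
  exists P x1 y1, [/\ coef_projection P, P x1 = x1, P y1 = y1,
    coef sg x y = coef sg x1 y1 & rnorm x1 <= rnorm x /\ rnorm y1 <= rnorm y].
Proof.
move=> Axy.
pose X1 v := coef_space pi (coef sg v y).
pose Y1 w := forall v, X1 v -> coef_space pi (coef sg v w).
have X1cl : closed_subspace (@hdot R V') X1 := coef_closed_left y.
have Y1cl : closed_subspace (@hdot R V') Y1.
  split=> [v _|c w w' Yw Yw' v Xv|w hw v Xv].
  - exact: csub0 (coef_closed_right v).
  - by apply: (csubP (coef_closed_right v)); [exact: Yw|exact: Yw'].
  - apply: (csub_closed (coef_closed_right v)) => e /hw[m Ym h].
    by exists m => //; apply: Ym.
have Zcl : closed_subspace (@hdot R V') (fun v => X1 v /\ Y1 v).
  split=> [|c w w' [Xw Yw] [Xw' Yw']|w hw].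
  - by split; [exact: csub0 X1cl|exact: csub0 Y1cl].
  - by split; [exact: (csubP X1cl)|exact: (csubP Y1cl)].
  - split; [apply: (csub_closed X1cl)|apply: (csub_closed Y1cl)] => e /hw[m [Xm Ym] h];
    by exists m.
have [P1 p1] := sip_projection D' (@hdot_complete R V') (@hdot_definite R V') X1cl.
have [P p] := sip_projection D' (@hdot_complete R V') (@hdot_definite R V') Zcl.
have X1rep s v : X1 v -> X1 (sg s v) by apply: coef_space_right_translate.
have Y1rep s w : Y1 w -> Y1 (sg s w).
  by move=> Yw v Xv; apply/coef_space_left_translate/Yw.
have proj_sym (M : V' -> Prop) Q : orthogonal_projection (@hdot R V') M Q ->
    forall m v, M m -> hdot m (Q v) = hdot m v.
  by move=> q m v Mm; rewrite (sipC D') (proj_dot q) // -(sipC D').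
have proj_rnorm (M : V' -> Prop) Q : orthogonal_projection (@hdot R V') M Q ->
    forall v, rnorm (Q v) <= rnorm v.
  move=> q v; rewrite -(@ler_pXn2r _ 2) ?nnegrE ?rnorm_ge0 // -!hdot_sip_sq.
  exact: proj_le q v.
have Zy : X1 (P1 y) /\ Y1 (P1 y).
  split; first exact: proj_in p1 y.
  move=> v Xv; have -> : coef sg v (P1 y) = coef sg v y => //.
  by apply/funext => s; rewrite /coef (proj_sym _ _ p1) //; apply: X1rep.
exists P, (P x), (P1 y); split.
- split.
  + exact: projP p.
  + exact: proj_rnorm p.
  + by move=> v; apply: (proj_id p); apply: proj_in p v.
  + move=> v w; rewrite -(proj_sym _ _ p _ w); last exact: proj_in p v.
    by rewrite (proj_dot p) //; apply: proj_in p w.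
  + move=> s v; apply: (proj_id p); have [Xv Yv] := proj_in p v.
    by split; [exact: X1rep|exact: Y1rep].
  + by move=> v w; apply: (proj_in p w).2; exact: (proj_in p v).1.
- by apply: (proj_id p); apply: proj_in p x.
- exact: proj_id p _ Zy.
- apply/funext => s; rewrite /coef -(proj_sym _ _ p1); last exact: X1rep.
  rewrite !rep_adjoint (proj_dot p) //.
  by split; [apply: X1rep Zy.1|apply: Y1rep Zy.2].
- by split; [exact: proj_rnorm p x|exact: proj_rnorm p1 y].
Qed.

(** If [T] is [pi s] then [S] is [sg s], compressed to the range of [P]; in
    general [S] is the operator by which the functional [T] on [A] acts in [sg]. *)
Definition extends (P : V' -> V') (T : V -> V) (S : V' -> V') : Prop :=
  forall x y, hdot (S x) y = pairing pi T (coef sg (P x) (P y)).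

Lemma extends_exists P T : coef_projection P -> spectrum pi T ->
  exists S, extends P T S.
Proof.
move=> p /spectrum_represents[bT _]; have [C C0 hC] := bounded_functional_nneg bT.
have linP := cp_linear p.
have [|||| S [_ SP _]] := @sesqui_riesz _ V'
    (fun x y => pairing pi T (coef sg (P x) (P y))) C.
- move=> c x y z; have -> : coef sg (P (c *: x + y)) (P z) =
      fun s => c * coef sg (P x) (P z) s + coef sg (P y) (P z) s.
    by apply/funext => s; rewrite /coef linP rep_linear (sipP D').
  by rewrite bT.1 //; apply: cp_coef.
- move=> c x y z; have -> : coef sg (P x) (P (c *: y + z)) =
      fun s => conjc c * coef sg (P x) (P y) s + coef sg (P x) (P z) s.
    by apply/funext => s; rewrite /coef linP (sipDr D') (sipZr D').
  by rewrite bT.1 //; apply: cp_coef.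
- by [].
- move=> x y; apply: le_trans (hC _ (cp_coef p _ _)) _; rewrite ler_wpM2l //.
  apply: le_trans (fs_norm_le _ _ _) _.
  by apply: ler_pM; rewrite ?rnorm_ge0 ?(cp_le p).
by exists S.
Qed.

Lemma ext_le P T S C x : coef_projection P -> extends P T S -> 0 <= C ->
  (forall u, coef_space pi u -> normc (pairing pi T u) <= C * fs_norm u) ->
  rnorm (S x) <= C * rnorm x.
Proof.
move=> p e C0 hC; have [->|h] := eqVneq (rnorm (S x)) 0.
  by rewrite mulr_ge0 ?rnorm_ge0.
rewrite -(@ler_pM2r _ (rnorm (S x))); last by rewrite lt_neqAle eq_sym h rnorm_ge0.
have -> : rnorm (S x) * rnorm (S x) = normc (hdot (S x) (S x)).
  by rewrite hdot_sq normc_real ger0_norm ?sqr_ge0.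
rewrite e -mulrA; apply: le_trans (hC _ (cp_coef p _ _)) _.
rewrite ler_wpM2l //; apply: le_trans (fs_norm_le _ _ _) _.
by apply: ler_pM; rewrite ?rnorm_ge0 ?(cp_le p).
Qed.

Lemma ext_projl P T S x : coef_projection P -> extends P T S -> P (S x) = S x.
Proof.
move=> p e; apply: hdot_ext => y.
by rewrite (cp_adjoint p) !e (cp_id p).
Qed.

(** The left-hand side makes no reference to [sg]: it is the module action of [T],
    as a functional, on a function of [A]. This is what makes transport
    multiplicative. *)
Lemma ext_translate P T S x y : coef_projection P -> extends P T S ->
  (fun s => pairing pi T (fun t => coef sg (P x) (P y) (s * t)%g)) =
  coef sg (P (S x)) (P y).
Proof.
move=> p e; apply/funext => s.
have -> : (fun t => coef sg (P x) (P y) (s * t)%g) =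
    coef sg (P x) (P (sg s^-1%g (P y))).
  by apply/funext => t; rewrite /coef rep_mulE rep_adjoint (cp_rep p).
by rewrite -e (ext_projl _ p e) /coef rep_adjoint.
Qed.

End Closedness.

Lemma coef_space_star u : coef_space pi u -> coef_space pi (fs_star u).
Proof.
move=> Au; have [[V' [sg [x [y uE]]]] _] := Au; rewrite uE in Au *.
have [P [x1 [y1 [p Px Py -> _]]]] := coef_projection_exists Au.
by rewrite fs_star_coef -Px -Py; apply: cp_coef.
Qed.

Lemma pairing_adjoint T T' u : spectrum pi T -> spectrum pi T' -> adjoint_of T T' ->
  coef_space pi u -> pairing pi T' u = conjc (pairing pi T (fs_star u)).
Proof.
move=> sT sT' TT' Au.
apply: (@functional_eq _ _ _ pi (ctisaP hA) (pairing pi T')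
  (fun v => conjc (pairing pi T (fs_star v)))) => //.
- by case: (spectrum_represents sT').
- have [bT _] := spectrum_represents sT; split=> [c v w Av Aw|].
    have -> : fs_star (fun s => c * v s + w s) = fun s => conjc c * fs_star v s + fs_star w s.
      by apply/funext => s; rewrite /fs_star conjcD conjcM.
    rewrite bT.1 ?conjcD ?conjcM ?conjcK //; exact: coef_space_star.
  have [C C0 hC] := bounded_functional_nneg bT; exists C => v Av.
  apply: fs_norm_ge => //; first exact: Av.1.
  move=> V' sg x y vE; rewrite normc_ReE normc_conj.
  apply: le_trans (hC _ (coef_space_star Av)) _; rewrite ler_wpM2l //.
  by rewrite vE fs_star_coef mulrC fs_norm_le.
- move=> x y; rewrite fs_star_coef.
  rewrite (spectrum_represents sT').2 (spectrum_represents sT).2 TT'.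
  by rewrite -(sipC (hdot_sip V)).
Qed.

(** The right-hand side is a functional of [u] that agrees with the left-hand
    side on the coefficients of [pi]; it is bounded since the inner function is
    a coefficient of the same representation as [u], with one vector moved by
    the transport of [T]. *)
Lemma pairing_comp S T u : spectrum pi S -> spectrum pi T -> spectrum pi (S \o T) ->
  coef_space pi u ->
  pairing pi (S \o T) u = pairing pi S (fun s => pairing pi T (fun t => u (s * t)%g)).
Proof.
move=> sS sT sST Au; have AP := ctisaP hA.
have [bS rS] := spectrum_represents sS; have [bT rT] := spectrum_represents sT.
have [CS CS0 hCS] := bounded_functional_nneg bS.
have [CT CT0 hCT] := bounded_functional_nneg bT.
have act v : coef_space pi v -> coef_space pi (fun s => pairing pi T (fun t => v (s * t)%g)) /\
    forall (V' : hilbertType R) (sg : unitary_rep G V') x y, v = coef sg x y ->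
      normc (pairing pi S (fun s => pairing pi T (fun t => v (s * t)%g))) <=
      CS * (CT * (rnorm x * rnorm y)).
  move=> Av; split.
    have [[V' [sg [x [y vE]]]] _] := Av; rewrite vE in Av *.
    have [P [x1 [y1 [p Px Py -> _]]]] := coef_projection_exists Av.
    have [Q q] := extends_exists p sT; rewrite -Px -Py (ext_translate _ _ p q).
    exact: cp_coef.
  move=> V' sg x y vE; rewrite vE in Av *.
  have [P [x1 [y1 [p Px Py -> [xx1 yy1]]]]] := coef_projection_exists Av.
  have [Q q] := extends_exists p sT; rewrite -Px -Py (ext_translate _ _ p q).
  apply: le_trans (hCS _ (cp_coef p _ _)) _; rewrite ler_wpM2l //.
  apply: le_trans (fs_norm_le _ _ _) _; rewrite mulrA (ext_projl _ p q) Py.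
  apply: ler_pM; rewrite ?rnorm_ge0 //.
  apply: le_trans (ext_le _ p q CT0 hCT) _; rewrite ler_wpM2l //.
apply: (@functional_eq _ _ _ pi AP (pairing pi (S \o T))
  (fun v => pairing pi S (fun s => pairing pi T (fun t => v (s * t)%g)))) => //.
- by case: (spectrum_represents sST).
- split=> [c v w Av Aw|].
    have -> : (fun s => pairing pi T (fun t => c * v (s * t)%g + w (s * t)%g)) =
      fun s => c * pairing pi T (fun t => v (s * t)%g) + pairing pi T (fun t => w (s * t)%g).
      apply/funext => s; rewrite bT.1 //.
      by have [] := ctisa_translation hA s Av.
      by have [] := ctisa_translation hA s Aw.
    by rewrite bS.1 //; [case: (act v Av)|case: (act w Aw)].
  exists (CS * CT) => v Av; apply: fs_norm_ge; [exact: Av.1|exact: mulr_ge0|].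
  by move=> V' sg x y vE; rewrite normc_ReE -mulrA; apply: (act v Av).2 vE.
- move=> x y; rewrite (spectrum_represents sST).2.
  have -> : (fun s => pairing pi T (fun t => coef pi x y (s * t)%g)) = coef pi (T x) y.
    apply/funext => s; rewrite [RHS]rep_adjoint -rT; congr pairing.
    by apply/funext => t; rewrite /coef rep_mulE rep_adjoint.
  by rewrite rS.
Qed.

Section ExtensionAlgebra.
Context {V' : hilbertType R} (sg : unitary_rep G V') (P : V' -> V').
Hypothesis p : coef_projection sg P.

Lemma ext_comp S T S' T' Q x : spectrum pi S -> spectrum pi T ->
  spectrum pi (S \o T) -> extends sg P S S' -> extends sg P T T' ->
  extends sg P (S \o T) Q -> Q x = S' (T' x).
Proof.
move=> sS sT sST eS eT eQ; apply: hdot_ext => y.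
rewrite eQ pairing_comp //; last exact: cp_coef p _ _.
by rewrite (ext_translate _ _ p eT) -eS.
Qed.

Lemma ext_adjoint T T' S S' : spectrum pi T -> spectrum pi T' -> adjoint_of T T' ->
  extends sg P T S -> extends sg P T' S' -> adjoint_of S S'.
Proof.
move=> sT sT' TT' eS eS' x y.
rewrite eS [RHS](sipC (hdot_sip V')) eS'.
rewrite (pairing_adjoint sT sT' TT'); last exact: cp_coef p _ _.
by rewrite conjcK fs_star_coef.
Qed.

End ExtensionAlgebra.
End Extension.

(** * Functions extended by zero from an open coset *)

Section OpenSubgroups.
Context {H : topologicalGroupType} (K : set H).

Lemma translate_continuous (a : H) : continuous (fun h => a * h)%g.
Proof.
move=> h; have := @mulg_continuous H (a, h).
apply: (@cvg_comp _ _ _ (fun h : H => (a, h)) (fun x : H * H => (x.1 * x.2)%g)).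
by apply: cvg_pair; [exact: cvg_cst|exact: cvg_id].
Qed.

Lemma open_translate (a : H) : open K -> open [set h | K (a * h)%g].
Proof. by move=> oK; apply: open_comp => // h _; apply: translate_continuous. Qed.

Hypotheses (K1 : K 1%g) (KV : forall x y, K x -> K y -> K (x * y^-1)%g).

Lemma subgroupV x : K x -> K x^-1%g.
Proof. by move=> Kx; rewrite -[x^-1%g]mul1g; apply: KV. Qed.

Lemma subgroupM x y : K x -> K y -> K (x * y)%g.
Proof. by move=> Kx Ky; rewrite -[y]invgK; apply: KV => //; apply: subgroupV. Qed.

Definition coset_repr (h : H) : H := xget 1%g [set t | K (t^-1 * h)%g].

Lemma coset_reprP h : K ((coset_repr h)^-1 * h)%g.
Proof.
by apply: (@xgetPex _ 1%g [set t | K (t^-1 * h)%g]); exists h; rewrite /= mulVg.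
Qed.

Lemma coset_repr_eq s t : (coset_repr s == coset_repr t) = `[< K (t^-1 * s)%g >].
Proof.
apply/eqP/asboolP => [e|Kts].
  have -> : (t^-1 * s)%g = (((coset_repr t)^-1 * t)^-1 * ((coset_repr s)^-1 * s))%g.
    by rewrite e invgM invgK mulgA mulgK.
  by apply: subgroupM; [apply: subgroupV|]; apply: coset_reprP.
rewrite /coset_repr; congr xget; apply/seteqP; split=> r /= Kr.
  have -> : (r^-1 * t)%g = ((r^-1 * s) * (t^-1 * s)^-1)%g.
    by rewrite invgM invgK mulgA mulgK.
  exact: KV.
have -> : (r^-1 * s)%g = ((r^-1 * t) * (t^-1 * s))%g by rewrite mulgA mulgK.
exact: subgroupM.
Qed.

End OpenSubgroups.

Section LabelledForm.
Context {R : realType} {V : hilbertType R}.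

(** The form is the sum, over the labels [t], of the squared norms of the sums of
    the [w a] with label [t]. *)
Lemma labelled_form_ge0 (A T : eqType) (f : seq A) (r : A -> T) (w : A -> V) :
  0 <= \sum_(a <- f) \sum_(b <- f) (if r a == r b then hdot (w a) (w b) else 0).
Proof.
pose cl t := \sum_(a <- f) (if r a == t then w a else 0).
have -> : \sum_(a <- f) \sum_(b <- f) (if r a == r b then hdot (w a) (w b) else 0) =
    \sum_(t <- undup (map r f)) hdot (cl t) (cl t); last first.
  by apply: sumr_ge0 => t _; apply: (sip_ge0 (hdot_sip V)).
under [RHS]eq_bigr do rewrite hdot_suml; rewrite [RHS]exchange_big.
rewrite [LHS]big_seq [RHS]big_seq; apply: eq_bigr => a af.
under [RHS]eq_bigr do rewrite hdot_sumr; rewrite [RHS]exchange_big.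
apply: eq_bigr => b _.
rewrite (bigD1_seq (r a)) ?undup_uniq ?mem_undup ?map_f //= eqxx big1 => [|t /negPf ta].
  by rewrite addr0 [r b == _]eq_sym; case: eqP => // _; rewrite (sip0r (hdot_sip V)).
by rewrite eq_sym ta (sip0l (hdot_sip V)).
Qed.
End LabelledForm.

Section StarRep.
Context {R : realType} {V V' : hilbertType R}.
Let D' := hdot_sip V'.

(** Instances are the group [F] acting on its own space and its transports to
    other representations. *)
Record group_star_rep (F : set (V -> V)) (e : V -> V) (inv : (V -> V) -> (V -> V))
    (rho : (V -> V) -> (V' -> V')) : Prop := {
  gsr_mul : forall S T x, F S -> F T -> rho (S \o T) x = rho S (rho T x);
  gsr_adjoint : forall T, F T -> adjoint_of (rho T) (rho (inv T))
}.

Context (Dl F : set (V -> V)) (e : V -> V) (inv : (V -> V) -> (V -> V)).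
Hypothesis sg : semigroup_subgroup Dl F e inv.
Context (rho : (V -> V) -> (V' -> V')) (hrho : group_star_rep F e inv rho).

Lemma gsr_inve : inv e = e.
Proof.
have Fe := sgrp_id sg; have [h _] := sgrp_mulV sg Fe.
by have [_ h'] := sgrp_mul1 sg (sgrp_inv sg Fe); rewrite -h'.
Qed.

Lemma gsr_invT T x : F T -> rho (inv T) (rho T x) = rho e x.
Proof.
move=> FT; rewrite -(gsr_mul hrho) //; last exact: (sgrp_inv sg FT).
by have [-> _] := sgrp_mulV sg FT.
Qed.

Lemma gsr_Tinv T x : F T -> rho T (rho (inv T) x) = rho e x.
Proof.
move=> FT; rewrite -(gsr_mul hrho) //; last exact: (sgrp_inv sg FT).
by have [_ ->] := sgrp_mulV sg FT.
Qed.

Lemma gsr_eT T x : F T -> rho e (rho T x) = rho T x.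
Proof.
move=> FT; rewrite -(gsr_mul hrho) //; last exact: (sgrp_id sg).
by have [-> _] := sgrp_mul1 sg FT.
Qed.

(** [rho e] is an orthogonal projection and [<rho T x, rho T x> = <rho e x, x>]. *)
Lemma gsr_contraction T x : F T -> rnorm (rho T x) <= rnorm x.
Proof.
have Fe := sgrp_id sg.
have sq y : hdot (rho e y) y = hdot (rho e y) (rho e y).
  by rewrite -{1}(gsr_eT y Fe) (gsr_adjoint hrho Fe) gsr_inve.
have ele y : rnorm (rho e y) <= rnorm y.
  have := hdot_CS (rho e y) y; rewrite sq hdot_sq normc_real ger0_norm ?sqr_ge0 // expr2.
  have [->|h] := eqVneq (rnorm (rho e y)) 0; first by rewrite rnorm_ge0.
  by rewrite ler_pM2l // lt_neqAle eq_sym h rnorm_ge0.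
move=> FT; suff -> : rnorm (rho T x) = rnorm (rho e x) by exact: ele.
apply/eqP; rewrite -(@eqrXn2 _ 2) ?rnorm_ge0 //; apply/eqP; apply: complexI.
rewrite -!hdot_sq (gsr_adjoint hrho FT) gsr_invT // -sq.
by rewrite (gsr_adjoint hrho Fe) gsr_inve.
Qed.

Context {H : topologicalGroupType} (K : set H) (a : H).
Hypotheses (oK : open K) (K1 : K 1%g) (KV : forall x y, K x -> K y -> K (x * y^-1)%g).
Let Y := [set (a * k)%g | k in K].
Context (alpha : H -> V -> V).
Hypothesis alphaF : forall h, Y h -> F (alpha h).
Hypothesis alpha_affine : forall x y z, Y x -> Y y -> Y z ->
  alpha (x * y^-1 * z)%g = alpha x \o inv (alpha y) \o alpha z.
Hypothesis alpha_continuous : forall x y,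
  {within Y, continuous (fun h => hdot (rho (alpha h) x) y : R[i]^o)}.

Lemma cosetP h : Y h <-> K (a^-1 * h)%g.
Proof.
split=> [[k Kk <-]|Kh]; first by rewrite mulgA mulVg mul1g.
by exists (a^-1 * h)%g => //; rewrite mulgA mulgV mul1g.
Qed.

(** The affine map [alpha] yields the representation
    [k |-> rho (alpha a)^-1 rho (alpha (a k))] of the open subgroup [K]. These are
    coefficients of the representation of [H] induced by it, for vectors
    supported on the trivial coset. *)
Definition induced_matrix (I : eqType) (v : I -> V') (i j : I) (h : H) : R[i] :=
  if `[< K h >] then hdot (rho (alpha (a * h)%g) (v i)) (rho (alpha a) (v j)) else 0.

Lemma base_in_coset : Y a. Proof. by exists 1%g => //; rewrite mulg1. Qed.

(** Only translates [s, t] in the same coset of [K] interact. For these, write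
    [s = r k] and [t = r k'] with the chosen representative [r] of the coset;
    since [alpha] is affine, the entry at [t^-1 s] is
    [<rho (alpha (a k)) v_i, rho (alpha (a k')) v_j>]. *)
Lemma induced_matrix_pd (I : eqType) (v : I -> V') :
  matrix_positive_definite (induced_matrix v).
Proof.
move=> f; pose r (b : R[i] * (H * I)) := coset_repr K b.2.1.
pose w (b : R[i] * (H * I)) :=
  b.1 *: rho (alpha (a * ((coset_repr K b.2.1)^-1 * b.2.1))%g) (v b.2.2).
have YK k : K k -> Y (a * k)%g by move=> Kk; exists k.
rewrite (_ : pd_form _ f f =
    \sum_(b <- f) \sum_(c <- f) (if r b == r c then hdot (w b) (w c) else 0)).
  exact: labelled_form_ge0.
apply: eq_bigr => b _; apply: eq_bigr => c _; rewrite /induced_matrix.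
rewrite /r coset_repr_eq //; case: asboolP => [Kbc|_]; last by rewrite mulr0.
have rbc : coset_repr K b.2.1 = coset_repr K c.2.1.
  by apply/eqP; rewrite coset_repr_eq //; apply/asboolP.
rewrite /w (sipZl D') (sipZr D') mulrA; congr (_ * _); rewrite rbc.
have Kb : K ((coset_repr K c.2.1)^-1 * b.2.1)%g by rewrite -rbc; apply: coset_reprP.
have Kc : K ((coset_repr K c.2.1)^-1 * c.2.1)%g by apply: coset_reprP.
set kb := (_ * b.2.1)%g in Kb *; set kc := (_ * c.2.1)%g in Kc *.
have -> : (a * (c.2.1^-1 * b.2.1))%g = (a * (a * kc)^-1 * (a * kb))%g.
  by rewrite /kb /kc !invgM !invgK !mulgA mulgVK mulgK.
have [[FA FB] FC] := (alphaF base_in_coset, alphaF (YK _ Kb), alphaF (YK _ Kc)).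
have FCi := sgrp_inv sg FC.
rewrite alpha_affine //; [|exact: base_in_coset|exact: YK|exact: YK].
rewrite (gsr_mul hrho) //; last exact: (sgrp_mul sg FA FCi).
rewrite (gsr_mul hrho) // -(adjoint_sym (gsr_adjoint hrho FA)) gsr_invT // gsr_eT //.
by rewrite (adjoint_sym (gsr_adjoint hrho FC)).
Qed.

(** On [K] this is the continuity of [alpha]; off [K] the function vanishes on a
    whole coset, which is open. *)
Lemma induced_matrix_continuous (I : eqType) (v : I -> V') i :
  continuous (induced_matrix v i i : H -> R[i]^o).
Proof.
move=> h; have [Kh|Kh] := pselect (K h); last first.
  have nK : \forall t \near h, ~ K t.
    have : nbhs h [set t | K (h^-1 * t)%g].
      by apply: open_nbhs_nbhs; split; [exact: open_translate|rewrite /= mulVg].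
    apply: filterS => t Kt Ktt; apply: Kh.
    have -> : h = (t * (h^-1 * t)^-1)%g by rewrite invgM invgK mulgA mulgV mul1g.
    exact: KV.
  apply/cvg_normcP => eps eps0; apply: filterS nK => t nt.
  by rewrite /induced_matrix !asboolF // subrr normc0.
have oY : open Y.
  rewrite (_ : Y = [set t | K (a^-1 * t)%g]); first exact: open_translate.
  by apply/seteqP; split=> t /cosetP.
have Yah : Y (a * h)%g by exists h.
have := @alpha_continuous (v i) (rho (alpha a) (v i)).
rewrite continuous_open_subspace // => /(_ (a * h)%g (mem_set Yah)) cY.
have c := cvg_comp _ _ (@translate_continuous H a h) cY.
apply/cvg_normcP => eps eps0; move/cvg_normcP: c => /(_ _ eps0).
have : \forall t \near h, K t by apply: open_nbhs_nbhs.
apply: filterS2 => t Kt; rewrite /induced_matrix !asboolT //.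
Qed.

(** The induced matrix is taken over the vectors [x_i] and [rho (alpha a)^-1 z_j];
    its [(i, j)] entry is the wanted function translated by [a], and translation
    is absorbed into the second vector by [om a]. *)
Lemma induced_coefficients (W : hilbertType R) (om : unitary_rep H W) m n
    (x : 'I_m -> V') (z : 'I_n -> V') : universal_rep om ->
  exists X : seq (('I_m -> W) * ('I_n -> W)),
  [/\ forall i j h, (if h \in Y then hdot (rho (alpha h) (x i)) (z j) else 0) =
        \sum_(p <- X) coef om (p.1 i) (p.2 j) h,
      forall i, \sum_(p <- X) rnorm (p.1 i) ^+ 2 <= rnorm (x i) ^+ 2 &
      forall j, \sum_(p <- X) rnorm (p.2 j) ^+ 2 <= rnorm (z j) ^+ 2].
Proof.
move=> hom; have FA := alphaF base_in_coset; have FAi := sgrp_inv sg FA; have Fe := sgrp_id sg.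
pose v (k : 'I_m + 'I_n) := match k with inl i => x i
  | inr j => rho (inv (alpha a)) (z j) end.
have [X XE] := gns hom (induced_matrix_pd v) (@induced_matrix_continuous _ v).
have normE k : \sum_(xi <- X) rnorm (xi k) ^+ 2 = rnorm (rho (alpha a) (v k)) ^+ 2.
  have := XE k k 1%g; rewrite /induced_matrix asboolT // mulg1 hdot_sq => h.
  apply: complexI; rewrite h rmorph_sum /=; apply: eq_bigr => xi _.
  by rewrite /coef rep1E hdot_sq.
exists [seq (fun i => xi (inl i), fun j => om a (xi (inr j))) | xi <- X]; split.
- move=> i j h; rewrite big_map /=.
  have -> : \sum_(xi <- X) coef om (xi (inl i)) (om a (xi (inr j))) h =
      \sum_(xi <- X) coef om (xi (inl i)) (xi (inr j)) (a^-1 * h)%g.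
    apply: eq_bigr => xi _; rewrite /coef rep_mulE.
    by rewrite [RHS]rep_adjoint invgK.
  rewrite -XE /induced_matrix.
  have -> : (h \in Y) = `[< K (a^-1 * h)%g >].
    by apply/idP/asboolP => [/set_mem/cosetP|/cosetP/mem_set].
  case: asboolP => // /cosetP Yh.
  rewrite mulgA mulgV mul1g /= gsr_Tinv //.
  rewrite -{1}(gsr_eT _ (alphaF Yh)) (gsr_adjoint hrho Fe) gsr_inve //.
- move=> i; rewrite big_map (normE (inl i)) /=.
  by rewrite ler_pXn2r ?nnegrE ?rnorm_ge0 // gsr_contraction.
- move=> j; rewrite big_map /=; under eq_bigr do rewrite rep_rnorm.
  rewrite (normE (inr j)) /= ler_pXn2r ?nnegrE ?rnorm_ge0 //.
  by apply: le_trans (gsr_contraction _ FA) _; apply: gsr_contraction.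
Qed.

End StarRep.

(** * Complete contractivity *)

Section MatrixNorm.
Context {R : realType} {W : hilbertType R}.

Lemma mxop_norm_contraction m (T : 'I_m -> 'I_m -> W -> W) (x : 'I_m -> W) :
  (forall k l, linear (T k l)) -> (mxop_norm T <= 1)%E ->
  \sum_k rnorm (\sum_l T k l (x l)) ^+ 2 <= \sum_l rnorm (x l) ^+ 2.
Proof.
move=> linT T1; set N := (X in _ <= X).
have N0 : 0 <= N by apply: sumr_ge0 => l _; apply: sqr_ge0.
have [N1|N1] := eqVneq N 0.
  rewrite N1 big1 // => k _; rewrite big1 ?rnorm0 ?expr0n // => l _.
  have -> : x l = 0; last exact: linear0E.
  apply: rnorm_eq0; apply/eqP; rewrite -sqrf_eq0 eq_le sqr_ge0 andbT -N1.
  by rewrite /N (bigD1 l) //= lerDl; apply: sumr_ge0 => i _; apply: sqr_ge0.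
have Np : 0 < N by rewrite lt_neqAle eq_sym N1.
set c := (Num.sqrt N)^-1; have c0 : 0 < c by rewrite invr_gt0 sqrtr_gt0.
have c2 : c ^+ 2 * N = 1 by rewrite exprVn sqr_sqrtr // mulVf.
have scale (y : W) : rnorm (c%:C *: y) ^+ 2 = c ^+ 2 * rnorm y ^+ 2.
  by rewrite rnormZ normc_real gtr0_norm // exprMn.
have : ((Num.sqrt (\sum_k rnorm (\sum_l T k l (c%:C *: x l)) ^+ 2))%:E <= 1)%E.
  apply: le_trans T1; apply: ereal_sup_ubound; exists (fun l => c%:C *: x l) => //=.
  by under eq_bigr do rewrite scale; rewrite -mulr_sumr c2.
have -> : \sum_k rnorm (\sum_l T k l (c%:C *: x l)) ^+ 2 =
    c ^+ 2 * \sum_k rnorm (\sum_l T k l (x l)) ^+ 2.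
  rewrite mulr_sumr; apply: eq_bigr => k _; rewrite -scale scaler_sumr.
  by under eq_bigr do rewrite (linearZE _ _ (linT _ _)).
set M := \sum_k _; have M0 : 0 <= M by apply: sumr_ge0 => l _; apply: sqr_ge0.
rewrite lee_fin -(ler_pXn2r (n := 2)) ?nnegrE ?sqrtr_ge0 // expr1n.
rewrite sqr_sqrtr; last by rewrite mulr_ge0 ?sqr_ge0.
by rewrite -c2 ler_pM2l // exprn_gt0.
Qed.

End MatrixNorm.

Section Main.
Context {R : realType} {G H : topologicalGroupType} {V : hilbertType R}.
Variable pi : unitary_rep G V.
Hypothesis hA : closed_translation_invariant_subalgebra (coef_space pi).
Hypothesis hone : forall T, spectrum pi T -> opnorm T = 1%E.
Context {W : hilbertType R} (om : unitary_rep H W).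
Hypothesis hom : universal_rep om.
Context (K : set H) (a : H).
Hypotheses (oK : open K) (K1 : K 1%g) (KV : forall x y, K x -> K y -> K (x * y^-1)%g).
Let Y := [set (a * k)%g | k in K].
Context (alpha : H -> V -> V).
Hypothesis hcont : {within Y, continuous (fun h : H => weak_star_embedding pi (alpha h))}.
Context (F : set (V -> V)) (e : V -> V) (inv : (V -> V) -> (V -> V)).
Hypothesis sgF : semigroup_subgroup (spectrum pi) F e inv.
Hypothesis alphaF : forall h, Y h -> F (alpha h).
Hypothesis alpha_affine : forall x y z, Y x -> Y y -> Y z ->
  alpha (x * y^-1 * z)%g = alpha x \o inv (alpha y) \o alpha z.

Let j := j_map pi Y alpha.

Lemma F_linear T : F T -> linear T.
Proof. by move=> /(sgrp_sub sgF)/spectrum_vNA/rep_vNA_bounded/bounded_opP[]. Qed.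

Lemma F_adjoint T : F T -> adjoint_of T (inv T).
Proof.
apply: (contraction_group_adjoint sgF) => [S|S x] FS; first exact: F_linear.
by apply: opnorm1_contraction; [exact: F_linear|apply/hone/(sgrp_sub sgF)].
Qed.

Lemma alpha_spectrum h : Y h -> spectrum pi (alpha h).
Proof. by move=> /alphaF/(sgrp_sub sgF). Qed.

Lemma pairing_alpha_continuous u : coef_space pi u ->
  {within Y, continuous (fun h => pairing pi (alpha h) u : R[i]^o)}.
Proof.
move=> Au h.
have := @proj_continuous _ (fun=> R[i]^o) (SigSub (mem_set Au) : set_type (coef_space pi))
  (weak_star_embedding pi (alpha h)).
move/(cvg_comp _ _ (@hcont h)).
exact.
Qed.

Lemma j_coef x y h : j (coef pi x y) h = if h \in Y then hdot (alpha h x) y else 0.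
Proof.
rewrite /j /j_map; case: ifPn => // /set_mem Yh.
by have [_ ->] := spectrum_represents hA (alpha_spectrum Yh).
Qed.

Lemma within_eq_continuous (f g : H -> R[i]^o) : (forall h, Y h -> f h = g h) ->
  {within Y, continuous f} -> {within Y, continuous g}.
Proof.
by move=> fg; apply: subspace_eq_continuous => h /set_mem; apply: fg.
Qed.

Lemma identity_star_rep : group_star_rep F e inv (fun T : V -> V => T).
Proof. by split=> // T; apply: F_adjoint. Qed.

Lemma j_coef_matrix m n (x : 'I_m -> V) (y : 'I_n -> V) :
  exists X : seq (('I_m -> W) * ('I_n -> W)),
  [/\ forall k l, j (coef pi (x k) (y l)) = pair_coef om [seq (p.1 k, p.2 l) | p <- X],
      forall k, \sum_(p <- X) rnorm (p.1 k) ^+ 2 <= rnorm (x k) ^+ 2 &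
      forall l, \sum_(p <- X) rnorm (p.2 l) ^+ 2 <= rnorm (y l) ^+ 2].
Proof.
have [|X [XE Xx Xy]] := induced_coefficients sgF identity_star_rep oK K1 KV alphaF
    alpha_affine _ x y hom.
  move=> v w; apply: (within_eq_continuous _ (pairing_alpha_continuous (coef_space_coef pi v w))).
  by move=> h /alpha_spectrum/(spectrum_represents hA)[_ ->].
exists X; split=> // k l; apply/funext => h.
by rewrite j_coef /pair_coef big_map XE.
Qed.

(** The representation [sg] is arbitrary, so this shows at once that [j] takes
    [A], and not just the coefficients of [pi], into [B(H)], and that it
    does so without increasing the norm. *)
Lemma j_pair_coef u (V' : hilbertType R) (sg : unitary_rep G V') (x y : V') :
  coef_space pi u -> u = coef sg x y ->
  exists X, [/\ j u = pair_coef om X,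
      \sum_(p <- X) rnorm p.1 ^+ 2 <= rnorm x ^+ 2 &
      \sum_(p <- X) rnorm p.2 ^+ 2 <= rnorm y ^+ 2].
Proof.
move=> Au uE; rewrite uE in Au *.
have [P [x1 [y1 [p Px Py -> [xx1 yy1]]]]] := coef_projection_exists hA Au.
have /choice[rho rhoP] : forall T, exists S, F T -> extends pi sg P T S.
  move=> T; have [FT|nF] := pselect (F T); last by exists id.
  by have [S eS] := extends_exists hA p (sgrp_sub sgF FT); exists S.
have sp T : F T -> spectrum pi T by move/(sgrp_sub sgF).
have hrho : group_star_rep F e inv rho.
  split=> [S T z FS FT|T FT].
  - have FST := sgrp_mul sgF FS FT.
    exact: (ext_comp hA p _ (sp _ FS) (sp _ FT) (sp _ FST) (rhoP _ FS) (rhoP _ FT) (rhoP _ FST)).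
  - have FTi := sgrp_inv sgF FT.
    exact: (ext_adjoint hA p (sp _ FT) (sp _ FTi) (F_adjoint FT) (rhoP _ FT) (rhoP _ FTi)).
have [|X [XE Xx Xy]] := induced_coefficients sgF hrho oK K1 KV alphaF
    alpha_affine _ (fun _ : 'I_1 => x1) (fun _ : 'I_1 => y1) hom.
  move=> v w; apply: (within_eq_continuous _ (pairing_alpha_continuous (cp_coef p v w))).
  by move=> h /alphaF/rhoP eh; rewrite eh.
exists [seq (q.1 ord0, q.2 ord0) | q <- X]; rewrite !big_map; split.
- apply/funext => h; rewrite /pair_coef big_map -XE /j /j_map; case: ifPn => // /set_mem Yh.
  by rewrite (rhoP _ (alphaF Yh)) Px Py.
- by apply: le_trans (Xx ord0) _; rewrite ler_pXn2r ?nnegrE ?rnorm_ge0.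
- by apply: le_trans (Xy ord0) _; rewrite ler_pXn2r ?nnegrE ?rnorm_ge0.
Qed.

Lemma j_pair_coefE u : coef_space pi u -> exists X, j u = pair_coef om X.
Proof.
move=> Au; have [[V' [sg [x [y uE]]]] _] := Au.
by have [X [-> _ _]] := j_pair_coef Au uE; exists X.
Qed.

Lemma j_linear c u v : coef_space pi u -> coef_space pi v ->
  j (fun s => c * u s + v s) = fun h => c * j u h + j v h.
Proof.
move=> Au Av; apply/funext => h; rewrite /j /j_map; case: ifPn => [/set_mem Yh|_].
  by have [[lin _] _] := spectrum_represents hA (alpha_spectrum Yh); rewrite lin.
by rewrite mulr0 addr0.
Qed.

Lemma j_mul u v : coef_space pi u -> coef_space pi v ->
  j (fun s => u s * v s) = fun h => j u h * j v h.
Proof.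
move=> Au Av; apply/funext => h; rewrite /j /j_map; case: ifPn => [/set_mem Yh|_].
  by have [_ _ mul] := alpha_spectrum Yh; rewrite mul.
by rewrite mulr0.
Qed.

Section Adjoint.
Context (T : W -> W) (vT : rep_vNA om T).

Lemma pairing_j_linear c u v : coef_space pi u -> coef_space pi v ->
  pairing om T (j (fun s => c * u s + v s)) =
  c * pairing om T (j u) + pairing om T (j v).
Proof.
move=> Au Av; rewrite j_linear //.
have [X ->] := j_pair_coefE Au; have [Z ->] := j_pair_coefE Av.
have linT : linear T by have /bounded_opP[] := rep_vNA_bounded vT.
rewrite pair_coefP !pairing_pair_coef // /op_sum big_cat big_map mulr_sumr /=.
congr (_ + _); apply: eq_bigr => p _.
by rewrite (linearZE _ _ linT) (sipZl (hdot_sip W)).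
Qed.

Lemma pairing_j_bounded : exists2 C, 0 <= C &
  forall u (V' : hilbertType R) (sg : unitary_rep G V') x y,
    coef_space pi u -> u = coef sg x y ->
    normc (pairing om T (j u)) <= C * (rnorm x * rnorm y).
Proof.
have /bounded_opP[linT [C C0 hC]] := rep_vNA_bounded vT.
exists C => // u V' sg x y Au uE; have [X [-> Xx Xy]] := j_pair_coef Au uE.
by rewrite pairing_pair_coef //; apply: op_sum_bound; rewrite ?rnorm_ge0.
Qed.

(** The operator [S] is the image of [T] under the adjoint of [j]. It belongs to
    the von Neumann algebra because [alpha] takes values there, so that the form
    defining [S] is invariant under the commutant of [pi]. *)
Lemma j_adjoint : exists S : V -> V, [/\ rep_vNA pi S,
  forall x y, hdot (S x) y = pairing om T (j (coef pi x y)) &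
  forall u, coef_space pi u -> pairing pi S u = pairing om T (j u)].
Proof.
have [C C0 hC] := pairing_j_bounded; pose D := hdot_sip V.
have Acoef := coef_space_coef pi.
have [|||| S [linS SE SC]] := @sesqui_riesz _ V
    (fun x y => pairing om T (j (coef pi x y))) C.
- move=> c x y z; have -> : coef pi (c *: x + y) z =
      fun s => c * coef pi x z s + coef pi y z s.
    by apply/funext => s; rewrite /coef rep_linear (sipP D).
  exact: pairing_j_linear.
- move=> c x y z; have -> : coef pi x (c *: y + z) =
      fun s => conjc c * coef pi x y s + coef pi x z s.
    by apply/funext => s; rewrite /coef (sipDr D) (sipZr D).
  exact: pairing_j_linear.
- by [].
- by move=> x y; apply: hC.
exists S; split=> //.
  rewrite rep_vNA_bicommutant; split; first by apply/bounded_opP; split=> //; exists C.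
  move=> B BC; have [B' _ BB'] := adjoint_exists (commutant_bounded BC).
  apply/funext => x; apply: hdot_ext => y /=; rewrite BB' !SE; congr (pairing om T _).
  apply/funext => h; rewrite !j_coef; case: ifPn => // /set_mem/alpha_spectrum/spectrum_vNA.
  rewrite rep_vNA_bicommutant => -[_ /(_ B BC) aB].
  by rewrite -BB'; congr (hdot _ _); exact: (congr1 (@^~ x) aB).
move=> v Av; apply: (@pairingE _ _ _ pi (ctisaP hA) S (fun u => pairing om T (j u))) => //.
split; last by move=> x y; rewrite SE.
split; first exact: pairing_j_linear.
exists C => u Au; apply: fs_norm_ge; [exact: Au.1|exact: C0|].
by move=> V' sg x y uE; apply: hC uE.
Qed.

End Adjoint.

(** With [y_k = sum_l S_kl x_l] and [N = sum_k |y_k|^2], the number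
    [N = sum <S_kl x_l, y_k>] is expressed through [T] and vectors of a multiple
    of the universal representation whose norms are controlled by those of the
    [x_l] and [y_k]. The contraction [T] then gives [N <= sqrt N]. *)
Lemma j_adjoint_contraction m (T : 'I_m -> 'I_m -> W -> W) (S : 'I_m -> 'I_m -> V -> V) :
  (forall k l, rep_vNA om (T k l)) ->
  (forall k l x y, hdot (S k l x) y = pairing om (T k l) (j (coef pi x y))) ->
  (mxop_norm T <= 1)%E -> (mxop_norm S <= 1)%E.
Proof.
move=> vT SE T1; apply: ge_ereal_sup => _ [x /= x1 <-]; rewrite lee_fin.
have linT k l : linear (T k l) by have /bounded_opP[] := rep_vNA_bounded (vT k l).
pose y k := \sum_l S k l (x l); set N := \sum_k _.
have N0 : 0 <= N by apply: sumr_ge0 => l _; apply: sqr_ge0.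
have [X [XE Xx Xy]] := j_coef_matrix x y.
have NE : N%:C = \sum_(p <- X) hdotn (fun k => \sum_l T k l (p.1 l)) p.2.
  rewrite rmorph_sum /= /hdotn exchange_big /=; apply: eq_bigr => k _.
  rewrite -hdot_sq -/(y k) {1}/y hdot_suml.
  under [RHS]eq_bigr do rewrite hdot_suml; rewrite exchange_big; apply: eq_bigr => l _.
  by rewrite SE XE pairing_pair_coef // /op_sum big_map.
have h : N <= \sum_(p <- X) Num.sqrt (sip_sq hdotn p.1) * Num.sqrt (sip_sq hdotn p.2).
  rewrite -[N]ger0_norm // -normc_real NE.
  elim: X {XE Xx Xy NE} => [|p X IH]; first by rewrite !big_nil normc0.
  rewrite !big_cons; apply: le_trans (le_normcD _ _) _; apply: lerD => //.
  rewrite -(@ler_pXn2r _ 2) ?nnegrE ?normc_ge0 ?mulr_ge0 ?sqrtr_ge0 //.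
  rewrite exprMn !sqr_sqrtr ?(sip_sq_ge0 hdotn_sip) //.
  apply: le_trans (sip_CauchySchwarz hdotn_sip _ _) _.
  rewrite ler_wpM2r ?(sip_sq_ge0 hdotn_sip) // !hdotn_sq.
  exact: mxop_norm_contraction.
have sq (q : ('I_m -> W) * ('I_m -> W) -> 'I_m -> W) (z : 'I_m -> V) :
    (forall k, \sum_(p <- X) rnorm (q p k) ^+ 2 <= rnorm (z k) ^+ 2) ->
    \sum_(p <- X) Num.sqrt (sip_sq hdotn (q p)) ^+ 2 <= \sum_k rnorm (z k) ^+ 2.
  move=> hq; under eq_bigr do rewrite sqr_sqrtr ?(sip_sq_ge0 hdotn_sip) // hdotn_sq.
  by rewrite exchange_big; apply: ler_sum => k _.
have h2 : N ^+ 2 <= N.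
  apply: (@le_trans _ _ (1 * N)); last by rewrite mul1r.
  apply: (@le_trans _ _ ((\sum_(p <- X) Num.sqrt (sip_sq hdotn p.1) *
    Num.sqrt (sip_sq hdotn p.2)) ^+ 2)).
    by rewrite ler_pXn2r ?nnegrE // (le_trans N0 h).
  apply: le_trans (sum_CauchySchwarz _ _ _) _.
  apply: ler_pM; try by apply: sumr_ge0 => p _; apply: sqr_ge0.
    exact: le_trans (sq fst x Xx) x1.
  exact: (sq snd y Xy).
rewrite -(ler_pXn2r (n := 2)) ?nnegrE ?sqrtr_ge0 // expr1n sqr_sqrtr //.
have [->|N1] := eqVneq N 0; first exact: ler01.
by rewrite -(@ler_pM2r _ N) ?mul1r -?expr2 // lt_neqAle eq_sym N1.
Qed.

Lemma j_completely_contractive : completely_contractive_hom pi om j.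
Proof.
split; first by move=> u /j_pair_coefE[X ->]; apply: pair_coef_fs.
- exact: j_linear.
- exact: j_mul.
move=> n u Au; apply: ge_ereal_sup => _ [m [T [vT T1 ->]]].
have /choice[S SP] : forall q : 'I_m * 'I_m, exists S : V -> V, [/\ rep_vNA pi S,
    forall x y, hdot (S x) y = pairing om (T q.1 q.2) (j (coef pi x y)) &
    forall v, coef_space pi v -> pairing pi S v = pairing om (T q.1 q.2) (j v)].
  by move=> q; apply: j_adjoint.
apply: ereal_sup_ubound; exists m, (\matrix_(k, l) S (k, l)); split.
- by move=> k l; rewrite mxE; case: (SP (k, l)).
- apply: (j_adjoint_contraction (T := fun k l => T k l)) => // k l x y.
  by rewrite mxE; case: (SP (k, l)) => _ ->.
congr cmx_norm; apply/funext => p; apply/funext => q; rewrite !mxE.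
by case: (SP (p.1, q.1)) => _ _ ->.
Qed.

End Main.

Theorem proposition2p12 (R : realType) (G H : topologicalGroupType)
    (hG : locally_compact_group G) (hH : locally_compact_group H)
    (V : hilbertType R) (pi : unitary_rep G V)
    (hA : closed_translation_invariant_subalgebra (coef_space pi))
    (hstar : star_semigroup (spectrum pi))
    (hone : forall T, spectrum pi T -> opnorm T = 1%E)
    (W : hilbertType R) (om : unitary_rep H W) (hom : universal_rep om)
    (Y : set H) (hY : open_coset Y)
    (alpha : H -> V -> V) (halpha : forall h, Y h -> spectrum pi (alpha h))
    (hcont : {within Y, continuous (fun h : H => weak_star_embedding pi (alpha h))})
    (haff : affine_map Y (spectrum pi) alpha) :
  completely_contractive_hom pi om (j_map pi Y alpha).
Proof.
have [K [a [oK K1 KV YE]]] := hY; have [F [e [inv [sgF alphaF affine]]]] := haff.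
subst Y; exact: (j_completely_contractive hA hone hom oK K1 KV hcont sgF alphaF affine).
Qed.
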